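(* Let $(R,\mathfrak m)$ be a one-dimensional Cohen-Macaulay local ring with infinite residue field and let $K$ be a canonical reduction of $R$. Then: (a) $R$ has minimal multiplicity if and only if $R$ is almost Gorenstein and $\ell(R/K)=2$. (b) If $\rho(R)=2$, then $R$ is almost Gorenstein with minimal multiplicity if and only if $\ell(R/K)=2$.
   Context: All rings are Noetherian and $\ell$ denotes length. $R$ has minimal multiplicity if $\mu(\mathfrak m)=e^0_{\mathfrak m}(R)$, where $\mu$ is the minimal number of generators and $e^0_{\mathfrak m}(R)$ is the multiplicity of $R$ with respect to $\mathfrak m$. A canonical ideal of $R$ is an ideal isomorphic to a canonical module of $R$. An ideal $J\subseteq I$ is a reduction of $I$ if $I^{n+1}=JI^n$ for some $n$. A canonical reduction of $R$ is a canonical ideal that is a reduction of $\mathfrak m$. The canonical index $\rho(R)$ is the reduction number of a canonical ideal $T$, i.e. the least $t$ such that $T^{t+1}=xT^t$ for some $x\in T$; it is independent of the choice of the canonical ideal $T$. A one-dimensional Cohen-Macaulay local ring $R$ is almost Gorenstein (in the sense of Goto, Matsuoka and Phuong) if it possesses a canonical ideal $I$ such that $e_1(I)\le r(R)$, where $r(R)=\ell(\operatorname{Ext}^1_R(R/\mathfrak m,R))$ is the Cohen-Macaulay type and $e_1(I)$ is the first Hilbert coefficient of $I$, i.e. $\ell(R/I^{n+1})=e_0(I)(n+1)-e_1(I)$ for all large $n$.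
   Formalization: In (a), the implication from minimal multiplicity to ''almost Gorenstein and ℓ(R/K)=2'' is stated only for non-regular R: for a discrete valuation ring K = m, μ(m)=e=1 and ℓ(R/K)=1, so it fails there. The converse and (b) are unrestricted. *)

(* Defs.v *)
From HB Require Import structures.
From mathcomp Require Import all_boot all_order all_algebra.
From mathcomp Require Import boolp classical_sets functions cardinality.

Set Implicit Arguments.
Unset Strict Implicit.
Unset Printing Implicit Defensive.

Import Order.TTheory GRing.Theory Num.Theory.
Local Open Scope classical_set_scope.
Local Open Scope ring_scope.

Definition chain (T : Type) (P : set (set T)) (n : nat) (c : nat -> set T) : Prop :=
  (forall i, (i <= n)%N -> P (c i)) /\
  (forall i, (i < n)%N -> c i `<` c i.+1).

Definition longest_chain (T : Type) (P : set (set T)) (n : nat) : Prop :=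
  (exists c, chain P n c) /\ (forall k c, chain P k c -> (k <= n)%N).

Section Modules.
Variable R : comNzRingType.
Implicit Types M C : lmodType R.

Definition submodule M (N : set M) : Prop :=
  N 0 /\ (forall (a : R) (x y : M), N x -> N y -> N (a *: x + y)).

Definition generated M (A : set M) : set M :=
  [set x | forall N : set M, submodule N -> A `<=` N -> N x].

Definition generates M (N : set M) (s : seq M) : Prop :=
  generated [set x | x \in s] = N.

Definition fin_gen M (N : set M) : Prop := exists s, generates N s.

(* the minimal number of generators of N is n *)
Definition min_num_gens M (N : set M) (n : nat) : Prop :=
  (exists2 s, generates N s & size s = n) /\
  (forall s, generates N s -> (n <= size s)%N).

(* For submodules N `<=` L of M: the quotient L / N has finite length l.  Its
   submodules are represented by the submodules of M between N and L. *)
Definition has_length M (N L : set M) (l : nat) : Prop :=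
  longest_chain [set X | [/\ submodule X, N `<=` X & X `<=` L]] l.

(* the submodule (s)M, where (s) is the ideal generated by s *)
Definition seq_mul (s : seq R) M : set M :=
  generated [set v | exists2 x, x \in s & exists w : M, v = x *: w].

Arguments seq_mul s M : clear implicits.

Definition regular_sequence M (s : seq R) : Prop :=
  (forall i, (i < size s)%N -> forall v : M,
     seq_mul (take i s) M (s`_i *: v) -> seq_mul (take i s) M v) /\
  seq_mul s M <> setT.

Definition injective_module (E : lmodType R) : Prop :=
  forall (A B : lmodType R) (j : {linear A -> B}) (f : {linear A -> E}),
    injective j -> exists g : {linear B -> E}, forall x, g (j x) = f x.

Definition finite_injective_dimension C : Prop :=
  exists (I : nat -> lmodType R) (eps : {linear C -> I 0%N})
         (d : forall i, {linear I i -> I i.+1}) (n : nat),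
    [/\ forall i, injective_module (I i),
        injective eps,
        forall x, d 0%N x = 0 <-> exists c, x = eps c,
        forall i x, d i.+1 x = 0 <-> exists y, x = d i y
      & forall i, (n < i)%N -> forall x : I i, x = 0].

(* A resolution  ... -> R^(n 1) -> R^(n 0) -> M / N -> 0  by finite free
   modules; the differentials act on row vectors by right multiplication, and
   the augmentation is given through a lift eps of it to M. *)
Definition free_resolution M (N : set M) (n : nat -> nat)
    (eps : {linear 'rV[R]_(n 0%N) -> M})
    (d : forall i, 'M[R]_(n i.+1, n i)) : Prop :=
  [/\ forall x, exists v, N (x - eps v),
      forall v, N (eps v) <-> exists w, v = w *m d 0%N
    & forall i (v : 'rV_(n i.+1)), v *m d i = 0 <-> exists w, v = w *m d i.+1].

(* Hom(R^p, C) = C^p; this is Hom(D, C) for the map D : R^q -> R^p. *)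
Definition hom_map C (p q : nat) (D : 'M[R]_(q, p))
    (f : {ffun 'I_p -> C}) : {ffun 'I_q -> C} :=
  [ffun j => \sum_k D j k *: f k].

Definition cocycles C (n : nat -> nat) (d : forall i, 'M[R]_(n i.+1, n i))
    (i : nat) : set {ffun 'I_(n i) -> C} :=
  [set f | hom_map (d i) f = 0].

Definition coboundaries C (n : nat -> nat) (d : forall i, 'M[R]_(n i.+1, n i))
    (i : nat) : set {ffun 'I_(n i) -> C} :=
  match i with
  | 0%N => [set 0]
  | j.+1 => range (@hom_map C (n j) (n j.+1) (d j))
  end.

(* Ext^i_R(M / N, C) has finite length l. *)
Definition ext_length M (N : set M) C (i l : nat) : Prop :=
  exists (n : nat -> nat) (eps : {linear 'rV[R]_(n 0%N) -> M})
         (d : forall i, 'M[R]_(n i.+1, n i)),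
    free_resolution N eps d /\
    has_length (@coboundaries C n d i) (@cocycles C n d i) l.

End Modules.

Section Rings.
Variable R : comNzRingType.
Implicit Types (I J m K T : set R).

Definition ideal I : Prop := @submodule R R^o I.

Definition ideal_mul I J : set R :=
  @generated R R^o [set z | exists x y, [/\ I x, J y & z = x * y]].

Definition ideal_exp I (n : nat) : set R := iter n (ideal_mul I) setT.

Definition prime_ideal I : Prop :=
  [/\ ideal I, ~ I 1 & forall x y, I (x * y) -> I x \/ I y].

Definition maximal_ideal I : Prop :=
  [/\ ideal I, ~ I 1 & forall J, ideal J -> ~ J 1 -> I `<=` J -> J = I].

Definition noetherian : Prop := forall I, ideal I -> @fin_gen R R^o I.

Definition local_ring m : Prop :=
  maximal_ideal m /\ (forall I, maximal_ideal I -> I = m).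

Definition krull_dim (d : nat) : Prop := longest_chain prime_ideal d.

Definition infinite_residue_field m : Prop :=
  infinite_set (range (fun x : R => [set y | m (y - x)])).

Definition depth m (M : lmodType R) (d : nat) : Prop :=
  (exists s : seq R,
     [/\ forall x, x \in s -> m x, regular_sequence M s & size s = d]) /\
  (forall s : seq R, (forall x, x \in s -> m x) -> regular_sequence M s ->
     (size s <= d)%N).

Definition cohen_macaulay m : Prop :=
  exists d, krull_dim d /\ depth m R^o d.

Definition regular_local m : Prop :=
  exists d, krull_dim d /\ @min_num_gens R R^o m d.

Definition colength I (l : nat) : Prop := @has_length R R^o I setT l.

(* A canonical module of the local ring (R, m): a maximal Cohen-Macaulay module
   of type 1 and of finite injective dimension. *)
Definition canonical_module m (C : lmodType R) : Prop :=
  [/\ @fin_gen R C setT,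
      exists d, krull_dim d /\ depth m C d,
      exists d, depth m C d /\ @ext_length R R^o m C d 1
    & finite_injective_dimension C].

Definition canonical_ideal m I : Prop :=
  exists C : lmodType R, canonical_module m C /\
    exists f : {linear C -> R^o}, injective f /\ range f = I.

Definition is_reduction J I : Prop :=
  J `<=` I /\
  exists n, ideal_exp I n.+1 = ideal_mul J (ideal_exp I n).

Definition canonical_reduction m K : Prop :=
  canonical_ideal m K /\ is_reduction K m.

Definition reduction_at T (t : nat) : Prop :=
  exists2 x, T x & ideal_exp T t.+1 = [set x * y | y in ideal_exp T t].

Definition reduction_number T (t : nat) : Prop :=
  reduction_at T t /\ (forall s, (s < t)%N -> ~ reduction_at T s).

(* rho(R) = t; the reduction number does not depend on T. *)
Definition canonical_index m (t : nat) : Prop :=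
  exists2 T, canonical_ideal m T & reduction_number T t.

(* l(R / I^(n+1)) = e0 (n+1) - e1 for all large n: the Hilbert coefficients of
   an m-primary ideal of a one-dimensional local ring *)
Definition hilbert_coefficients I (e0 e1 : int) : Prop :=
  exists n0, forall n, (n0 <= n)%N ->
    exists2 l, colength (ideal_exp I n.+1) l & l%:Z = e0 * n.+1%:Z - e1.

(* stated for one-dimensional R, where the multiplicity e of m is e0(m) *)
Definition minimal_multiplicity m : Prop :=
  exists e : nat, @min_num_gens R R^o m e /\
    exists e1, hilbert_coefficients m e%:Z e1.

Definition cm_type_dim1 m (r : nat) : Prop := @ext_length R R^o m R^o 1 r.

Definition almost_gorenstein m : Prop :=
  exists2 I, canonical_ideal m I &
    exists e0 e1 r,
      [/\ hilbert_coefficients I e0 e1, cm_type_dim1 m r & e1 <= r%:Z].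

End Rings.

(* Main.v *)
(** Colengths of ideals carry the whole argument.  Let x in K generate a reduction
    of K (it exists because the residue field is infinite), hence of m, and put
    e = l(R/xR), so that e = e0(m).  Duality in the module K/xK, whose socle is
    simple, gives (xK : K) = xR and r(R) = l(K/mK).

    - Minimal multiplicity means m^2 = xm.  Then mK = xm and, outside the regular
      case, r(R) = e - 1, so that l(R/K) = 2; moreover e1(K) <= l(m/xR) = r(R).
    - If R is almost Gorenstein, then mK <= xR: either K^n = x^(n-1) K for some
      n >= 2, hence K = xR, or e1(K) >= 1 + l(K/xR) and so l(K/xR) < l(K/mK).
      If l(R/K) = 2, this gives r(R) = e - 1, that is, m^2 <= xR.
    - If K^3 = xK^2, the conductor c = (xR : K) contains K, and K = c would force
      K^2 <= xK, that is, K = xR.  Thus l(R/K) = 2 and K <> xR imply c = m.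

    Two canonical ideals I, K satisfy aI = bK with a, b regular, so everything can
    be read off K; if T is canonical and T^3 = yT^2, then y is regular because T,
    having finite injective dimension, is faithful. *)
From HB Require Import structures.
From mathcomp Require Import all_boot all_order all_algebra.
From mathcomp Require Import boolp classical_sets functions cardinality.
From mathcomp Require Import zify ring.
Require Import Defs.

Set Implicit Arguments.
Unset Strict Implicit.
Unset Printing Implicit Defensive.
Import GRing.Theory Num.Theory.

(** * Lengths *)

Section Length.
Local Open Scope classical_set_scope.
Local Open Scope ring_scope.
Variables (R : comNzRingType) (M : lmodType R).
Implicit Types (N L P X : set M) (c : nat -> set M).

(** No quotient, Hom module or residue field is formed: a subquotient L/N is a pair of submodules,
    and the dual of R/J in K/yK is the ideal of all k in K with kJ inside yK. Adjoining one socle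
    element changes a colength by 1 and the colength of the dual by at most 1, so an inclusion of
    ideals yields an inequality of lengths; as the duals of yR and of R are known, the two
    inequalities along yR, J, R are equalities. This rests only on the simple socle of K/yK, which
    comes from the shift of Ext^1(R/m, C) to the socle of C/yC.

    The bound e1(K) >= 1 + l(K/xR) has this source: e1(K) = ne - l(R/K^n) for large n, and if K^n is
    strictly larger than x^(n-1)K, then l(R/K^n) <= (n-1)e + l(R/K) - 1.

    Finite injective dimension enters at one place. The index is witnessed by some [T] and some [y]
    in [T] that might be a zero divisor; faithfulness of [T] makes [y] regular, which also gives [T]
    finite colength and so makes it comparable with [K]. *)

Lemma submodule0 N : submodule N -> N 0. Proof. by case. Qed.

Lemma submoduleD N x y : submodule N -> N x -> N y -> N (x + y).
Proof. by move=> [_ h] Nx Ny; rewrite -(scale1r x); exact: h. Qed.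

Lemma submoduleZ N a x : submodule N -> N x -> N (a *: x).
Proof. by move=> [N0 h] Nx; rewrite -(addr0 (a *: x)); exact: h. Qed.

Lemma submoduleN N x : submodule N -> N x -> N (- x).
Proof. by move=> sN Nx; rewrite -scaleN1r; exact: submoduleZ. Qed.

Lemma submoduleB N x y : submodule N -> N x -> N y -> N (x - y).
Proof. by move=> sN Nx Ny; apply: submoduleD => //; exact: submoduleN. Qed.

Lemma submoduleBl N x y : submodule N -> N y -> N (x - y) -> N x.
Proof. by move=> sN Ny Nxy; rewrite -(subrK y x); exact: submoduleD. Qed.

Lemma submoduleP N : N 0 -> (forall x y, N x -> N y -> N (x + y)) ->
  (forall a x, N x -> N (a *: x)) -> submodule N.
Proof. by move=> N0 ND NZ; split=> // a x y Nx Ny; apply: ND => //; exact: NZ. Qed.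

Definition sub_add N P : set M := [set z | exists x y, [/\ N x, P y & z = x + y]].

Lemma submodule_add N P : submodule N -> submodule P -> submodule (sub_add N P).
Proof.
move=> sN sP; split; first by exists 0, 0; rewrite addr0; split=> //; exact: submodule0.
move=> a _ _ [x [y [Nx Py ->]]] [x' [y' [Nx' Py' ->]]].
exists (a *: x + x'), (a *: y + y'); split; [exact: sN.2|exact: sP.2|].
by rewrite scalerDr addrACA.
Qed.

Lemma sub_addl N P : submodule P -> N `<=` sub_add N P.
Proof. by move=> sP x Nx; exists x, 0; rewrite addr0; split=> //; exact: submodule0. Qed.

Lemma sub_addr N P : submodule N -> P `<=` sub_add N P.
Proof. by move=> sN x Px; exists 0, x; rewrite add0r; split=> //; exact: submodule0. Qed.

Lemma sub_add_min N P L : submodule L -> N `<=` L -> P `<=` L -> sub_add N P `<=` L.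
Proof. by move=> sL NL PL _ [x [y [/NL Lx /PL Ly ->]]]; exact: submoduleD. Qed.

Lemma submoduleI N P : submodule N -> submodule P -> submodule (N `&` P).
Proof.
move=> sN sP; split; first by split; exact: submodule0.
by move=> a x y [Nx Px] [Ny Py]; split; [exact: sN.2|exact: sP.2].
Qed.

Definition between N L := [set X | [/\ submodule X, N `<=` X & X `<=` L]].

Lemma has_length_uniq N L k l : has_length N L k -> has_length N L l -> k = l.
Proof.
move=> [[c hc] hk] [[c' hc'] hl].
by apply/eqP; rewrite eqn_leq (hl _ _ hc) (hk _ _ hc').
Qed.

Lemma chain0 N L X : between N L X -> chain (between N L) 0 (fun=> X).
Proof. by move=> h; split=> // i; rewrite leqn0 => /eqP ->. Qed.

Lemma chain_snoc N L k c X : chain (between N L) k c -> between N L X ->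
  c k `<` X -> chain (between N L) k.+1 (fun i => if (i <= k)%N then c i else X).
Proof.
move=> [h1 h2] hX hs; split=> i hi /=.
  by case: ifP => // /h1.
rewrite ltnS in hi; rewrite hi; case: ifP => hi'; first exact: h2.
by have -> : i = k by lia.
Qed.

Lemma has_length_exists N L b : submodule N -> submodule L -> N `<=` L ->
  (forall k c, chain (between N L) k c -> (k <= b)%N) ->
  exists l, has_length N L l.
Proof.
move=> sN sL NL hb; pose p k := `[< exists c, chain (between N L) k c >].
have ex0 : exists k, p k.
  by exists 0%N; apply/asboolP; exists (fun=> N); apply: chain0; split.
have hp k : p k -> (k <= b)%N by move=> /asboolP[c]; exact: hb.
case: (ex_maxnP ex0 hp) => l /asboolP hl hmax; exists l; split=> // k c hc.
by apply: hmax; apply/asboolP; exists c.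
Qed.

Lemma chain_cat N P L a b c c' : N `<=` P -> P `<=` L ->
  chain (between N P) a c -> chain (between P L) b c' ->
  chain (between N L) (a + b) (fun i => if (i < a)%N then c i else c' (i - a)%N).
Proof.
move=> NP PL [h1 h2] [h1' h2']; split=> i hi /=.
  case: ifP => hia.
    by have [] := h1 i (ltnW hia) => s1 s2 s3; split=> //; exact: subset_trans PL.
  have [] := h1' (i - a)%N; first by lia.
  by move=> s1 s2 s3; split=> //; exact: subset_trans s2.
case: ifP => hia; case: ifP => hia'.
- exact: h2.
- have ea : i.+1 = a by lia.
  rewrite ea subnn; have [_ _ sP] := h1 a (leqnn a); have [_ Ps _] := h1' 0%N (leq0n b).
  have := h2 i hia; rewrite ea => -[s1 s2]; split=> [x /s1/sP/Ps//|s3].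
  by apply: s2 => x /sP/Ps/s3.
- lia.
- by rewrite subSn; [apply: h2'; lia|lia].
Qed.

(** If [X] and [Y] had the same intersection with [P] and the same sum with [P], the modular law
    would give [X = Y]. *)
Lemma modular X Y P : submodule X -> submodule Y -> submodule P -> X `<` Y ->
  (X `&` P `<` Y `&` P) \/ (sub_add X P `<` sub_add Y P).
Proof.
move=> sX sY sP [XY nYX]; case: (pselect (Y `&` P `<=` X `&` P)) => h; last first.
  by left; split=> // x [/XY].
right; split; first by move=> _ [x [y [/XY Yx Py ->]]]; exists x, y.
move=> h'; apply: nYX => y Yy.
have [x [p [Xx Pp e]]] := h' _ (sub_addl sP Yy).
have ep : p = y - x by rewrite e addrC addKr.
have [Xp _] : (X `&` P) p by apply: h; split=> //; rewrite ep; apply: submoduleB => //; exact: XY.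
by rewrite e; exact: submoduleD.
Qed.

(** By [modular], each step of the chain stays strict in the traces on [P] or in the sums with [P].
    The inclusions of the last terms keep the next appended step strict. *)
Lemma chain_split N P L k c : submodule P -> N `<=` P -> P `<=` L -> submodule L ->
  chain (between N L) k c ->
  exists a b c1 c2, [/\ (k <= a + b)%N,
    chain (between N P) a c1, c1 a `<=` c k `&` P,
    chain (between P L) b c2 & c2 b `<=` sub_add (c k) P].
Proof.
move=> sP NP PL sL; elim: k => [|k IH] hc.
  have [sc Nc cL] := hc.1 0%N (leqnn 0%N).
  exists 0%N, 0%N, (fun=> c 0%N `&` P), (fun=> sub_add (c 0%N) P); split=> //.
    apply: chain0; split; [exact: submoduleI| by move=> x Nx; split; [exact: Nc|exact: NP] |by move=> x []].
  apply: chain0; split; [exact: submodule_add|exact: sub_addr|].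
  by apply: sub_add_min.
have hc' : chain (between N L) k c.
  by split=> i hi; [apply: hc.1|apply: hc.2]; lia.
have [a [b [c1 [c2 [hk h1 t1 h2 t2]]]]] := IH hc'.
have [sX NX XL] := hc.1 k (leqnSn k).
have [sY NY YL] := hc.1 k.+1 (leqnn _).
have XY := hc.2 k (leqnn _).
case: (modular sX sY sP XY) => [[s1 s2]|[s1 s2]].
  exists a.+1, b, (fun i => if (i <= a)%N then c1 i else c k.+1 `&` P), c2; split=> //.
  - apply: chain_snoc => //.
      split; [exact: submoduleI|by move=> x Nx; split; [exact: NY|exact: NP]|by move=> x []].
    by split=> [x /t1/s1//|h]; apply: s2 => x /h/t1.
  - by rewrite ltnn.
  - by move=> x /t2 [u [v [Xu Pv ->]]]; exists u, v; split=> //; exact: XY.1.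
exists a, b.+1, c1, (fun i => if (i <= b)%N then c2 i else sub_add (c k.+1) P); split=> //.
- lia.
- by move=> x /t1 [/XY.1].
- apply: chain_snoc => //.
    by split; [exact: submodule_add|exact: sub_addr|exact: sub_add_min].
  by split=> [x /t2/s1//|h]; apply: s2 => x /h/t2.
- by rewrite ltnn.
Qed.

Lemma has_length_add N P L a b : submodule P ->
  submodule L -> N `<=` P -> P `<=` L ->
  has_length N P a -> has_length P L b -> has_length N L (a + b).
Proof.
move=> sP sL NP PL [[c hc] ha] [[c' hc'] hb]; split.
  by eexists; exact: (chain_cat NP PL hc hc').
move=> k d /(chain_split sP NP PL sL) [a' [b' [c1 [c2 [hk h1 _ h2 _]]]]].
by apply: (leq_trans hk); apply: leq_add; [exact: ha h1|exact: hb h2].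
Qed.

Lemma has_length_split N P L l : submodule N -> submodule P -> submodule L ->
  N `<=` P -> P `<=` L -> has_length N L l ->
  exists a b, [/\ has_length N P a, has_length P L b & l = (a + b)%N].
Proof.
move=> sN sP sL NP PL hl.
have [a ha] : exists a, has_length N P a.
  apply: (@has_length_exists _ _ l) => // k c [h1 h2]; apply: (hl.2 k c); split=> // i /h1 [? ? ?].
  by split=> //; exact: subset_trans PL.
have [b hb] : exists a, has_length P L a.
  apply: (@has_length_exists _ _ l) => // k c [h1 h2]; apply: (hl.2 k c); split=> // i /h1 [? ? ?].
  by split=> //; exact: subset_trans NP _.
exists a, b; split=> //; apply: has_length_uniq hl _; exact: has_length_add ha hb.
Qed.

Lemma has_length0 N : submodule N -> has_length N N 0.
Proof.
move=> sN; split; first by exists (fun=> N); apply: chain0; split.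
move=> k c [h1 h2]; rewrite leqNgt; apply/negP => k0.
have [_ h _] := h1 0%N (leq0n _); have [_ _ h'] := h1 1%N k0.
by apply: (h2 0%N k0).2 => x /h'/h.
Qed.

Lemma has_length0_eq N L : submodule N -> submodule L -> N `<=` L -> has_length N L 0 -> N = L.
Proof.
move=> sN sL NL [_ h]; apply/seteqP; split=> //; apply: contrapT => nLN.
suff: (1 <= 0)%N by [].
apply: (h 1%N (fun i => if i == 0%N then N else L)); split.
  by move=> i _; case: ifP => _; split.
by move=> i; rewrite ltnS leqn0 => /eqP ->; split.
Qed.

End Length.

(** * Invariance of length under isomorphisms of subquotients *)

Section Transport.
Local Open Scope classical_set_scope.
Local Open Scope ring_scope.
Variables (R : comNzRingType) (M M' : lmodType R).

Lemma longest_chain_transport (T T' : Type) (P : set (set T)) (P' : set (set T'))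
    (F : set T -> set T') (G : set T' -> set T) l :
  (forall X, P X -> P' (F X)) -> (forall X, P' X -> P (G X)) ->
  (forall X Y, P X -> P Y -> X `<` Y -> F X `<` F Y) ->
  (forall X Y, P' X -> P' Y -> X `<` Y -> G X `<` G Y) ->
  longest_chain P l -> longest_chain P' l.
Proof.
move=> FP GP Fs Gs [[c [h1 h2]] h]; split.
  exists (F \o c); split=> i hi /=; first by apply/FP/h1.
  by apply: Fs; [apply: h1; lia|apply: h1|exact: h2].
move=> k d [h1' h2']; apply: (h k (G \o d)); split=> i hi /=; first by apply/GP/h1'.
by apply: Gs; [apply: h1'; lia|apply: h1'|exact: h2'].
Qed.

Variables (f : M -> M') (N L : set M) (N' L' : set M').
Hypothesis f_lin : forall a u v, f (a *: u + v) = a *: f u + f v.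
Hypotheses (sL : submodule L) (sN' : submodule N') (sL' : submodule L').
Hypotheses (NL : N `<=` L) (NL' : N' `<=` L').
Hypothesis fL : forall v, L v -> L' (f v).
Hypothesis fN : forall v, L v -> (N' (f v) <-> N v).
Hypothesis f_surj : forall w, L' w -> exists2 v, L v & N' (w - f v).

Let f0 : f 0 = 0.
Proof.
have := f_lin 1 0 0; rewrite !scale1r !addr0 => e.
by apply: (addrI (f 0)); rewrite addr0 -e.
Qed.
Let fB u v : f (u - v) = f u - f v.
Proof. by rewrite addrC -scaleN1r f_lin scaleN1r addrC. Qed.

Let F X : set M' := [set w | L' w /\ exists2 v, X v & N' (w - f v)].
Let G Y : set M := [set v | L v /\ Y (f v)].

Let F_between X : between N L X -> between N' L' (F X).
Proof.
move=> [sX NX XL]; split; last by move=> w [].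
  split.
    split; first exact: submodule0.
    by exists 0; [exact: submodule0|rewrite f0 subr0; exact: submodule0].
  move=> a w w' [Lw [v Xv Nv]] [Lw' [v' Xv' Nv']]; split; first exact: sL'.2.
  exists (a *: v + v'); first exact: sX.2.
  rewrite f_lin opprD addrACA -scalerBr; exact: sN'.2.
move=> w Nw; split; first exact: NL'.
by exists 0; [exact: submodule0|rewrite f0 subr0].
Qed.

Let G_between Y : between N' L' Y -> between N L (G Y).
Proof.
move=> [sY NY YL]; split; last by move=> w [].
  split; first by split; [exact: submodule0|rewrite f0; exact: submodule0].
  by move=> a w w' [Lw Yw] [Lw' Yw']; split; [exact: sL.2|rewrite f_lin; exact: sY.2].
by move=> v Nv; split; [exact: NL|apply: NY; apply/fN => //; exact: NL].
Qed.

Let F_strict X Y : between N L X -> between N L Y -> X `<` Y -> F X `<` F Y.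
Proof.
move=> [sX NX XL] [sY NY YL] [XY nYX]; split.
  by move=> w [Lw [v Xv Nv]]; split=> //; exists v => //; exact: XY.
move=> h; apply: nYX => v Yv.
have [|_ [u Xu]] := h (f v).
  by split; [apply/fL/YL|exists v => //; rewrite subrr; exact: submodule0].
rewrite -fB => /fN Nvu; apply: (submoduleBl sX Xu); apply/NX/Nvu.
by apply: submoduleB => //; [exact: YL|exact: XL].
Qed.

Let G_strict X Y : between N' L' X -> between N' L' Y -> X `<` Y -> G X `<` G Y.
Proof.
move=> [sX NX XL] [sY NY YL] [XY nYX]; split.
  by move=> w [Lw /XY].
move=> h; apply: nYX => w Yw.
have [v Lv Nv] := f_surj (YL _ Yw).
have Yv : Y (f v).
  have := submoduleB sY Yw (NY _ Nv); by rewrite opprB addrC subrK.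
have [_ Xv] := h v (conj Lv Yv).
by apply: (submoduleBl sX Xv); exact: NX.
Qed.

(** The hypotheses make [f] an isomorphism of L/N onto L'/N', so [f_surj] asks for preimages only
    modulo [N']. Images [F] and preimages [G] carry strict chains both ways. *)
Lemma has_length_transport l : has_length N L l <-> has_length N' L' l.
Proof.
split; apply: longest_chain_transport.
- exact: F_between.
- exact: G_between.
- exact: F_strict.
- exact: G_strict.
- exact: G_between.
- exact: F_between.
- exact: G_strict.
- exact: F_strict.
Qed.

End Transport.

(** * Colengths in a local ring *)

Section Ideals.
Local Open Scope classical_set_scope.
Local Open Scope ring_scope.
Variable R : comNzRingType.
Implicit Types (I J L N : set R) (x y a b : R).

Lemma ideal0 I : ideal I -> I 0. Proof. exact: submodule0. Qed.
Lemma idealD I x y : ideal I -> I x -> I y -> I (x + y).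
Proof. exact: (@submoduleD R R^o). Qed.
Lemma idealB I x y : ideal I -> I x -> I y -> I (x - y).
Proof. exact: (@submoduleB R R^o). Qed.
Lemma idealN I x : ideal I -> I x -> I (- x).
Proof. exact: (@submoduleN R R^o). Qed.
Lemma idealM I a x : ideal I -> I x -> I (a * x).
Proof. exact: (@submoduleZ R R^o). Qed.
Lemma idealMR I a x : ideal I -> I x -> I (x * a).
Proof. by rewrite mulrC; exact: idealM. Qed.
Lemma idealP I : I 0 -> (forall x y, I x -> I y -> I (x + y)) ->
  (forall a x, I x -> I (a * x)) -> ideal I.
Proof. exact: (@submoduleP R R^o). Qed.
Lemma idealT : ideal (setT : set R). Proof. by []. Qed.
Lemma ideal1 I : ideal I -> I 1 -> I = setT.
Proof. by move=> iI I1; apply/seteqP; split=> // x _; rewrite -(mulr1 x); exact: idealM. Qed.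

Definition add_ideal I J : set R := @sub_add R R^o I J.
Lemma ideal_add I J : ideal I -> ideal J -> ideal (add_ideal I J).
Proof. exact: (@submodule_add R R^o). Qed.
Lemma add_ideall I J : ideal J -> I `<=` add_ideal I J.
Proof. exact: (@sub_addl R R^o). Qed.
Lemma add_idealr I J : ideal I -> J `<=` add_ideal I J.
Proof. exact: (@sub_addr R R^o). Qed.
Lemma add_ideal_min I J L : ideal L -> I `<=` L -> J `<=` L -> add_ideal I J `<=` L.
Proof. exact: (@sub_add_min R R^o). Qed.

Definition scale x I : set R := [set x * y | y in I].

Lemma ideal_scale x I : ideal I -> ideal (scale x I).
Proof.
move=> iI; split; first by exists 0; [exact: ideal0|rewrite mulr0].
move=> a _ _ [y Iy <-] [z Iz <-]; exists (a * y + z); first exact: iI.2.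
by rewrite mulrDr mulrCA.
Qed.

Lemma scale_sub x I : ideal I -> scale x I `<=` I.
Proof. by move=> iI _ [y Iy <-]; exact: idealM. Qed.

Lemma scaleS x I J : I `<=` J -> scale x I `<=` scale x J.
Proof. by move=> IJ _ [y /IJ Jy <-]; exists y. Qed.

Lemma scaleA x y I : scale x (scale y I) = scale (x * y) I.
Proof.
apply/seteqP; split=> [_ [_ [z Iz <-] <-]|_ [z Iz <-]]; first by exists z; rewrite ?mulrA.
by exists (y * z); [exists z|rewrite mulrA].
Qed.

Lemma scale1 I : scale 1 I = I.
Proof.
by apply/seteqP; split=> [_ [z Iz <-]|z Iz]; [rewrite mul1r|exists z; rewrite ?mul1r].
Qed.

Lemma scaleT x : scale x setT x. Proof. by exists 1; rewrite ?mulr1. Qed.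

Lemma scaleT_min x I : ideal I -> I x -> scale x setT `<=` I.
Proof. by move=> iI Ix _ [y _ <-]; exact: idealMR. Qed.

Definition colon I J : set R := [set a | forall b, J b -> I (a * b)].

Lemma ideal_colon I J : ideal I -> ideal (colon I J).
Proof.
move=> iI; split; first by move=> b _; rewrite mul0r; exact: ideal0.
by move=> a x y hx hy b Jb; rewrite mulrDl -mulrA; apply: iI.2; [exact: hx|exact: hy].
Qed.

Lemma colon_sub I J : ideal I -> I `<=` colon I J.
Proof. by move=> iI a Ia b _; exact: idealMR. Qed.

Lemma in_mul I J x y : I x -> J y -> ideal_mul I J (x * y).
Proof. by move=> Ix Jy N _; apply; exists x, y. Qed.

Lemma ideal_ideal_mul I J : ideal (ideal_mul I J).
Proof.
split; first by move=> N sN _; exact: sN.1.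
by move=> a x y hx hy N sN h; apply: sN.2; [exact: hx|exact: hy].
Qed.

Lemma ideal_mul_min I J L : ideal L -> (forall x y, I x -> J y -> L (x * y)) ->
  ideal_mul I J `<=` L.
Proof. by move=> iL h z; apply=> // _ [x [y [Ix Jy ->]]]; exact: h. Qed.

Lemma ideal_mul_colon I J L : ideal L -> ideal_mul I J `<=` L <-> I `<=` colon L J.
Proof.
move=> iL; split=> [h x Ix y Jy|h]; first exact: h _ (in_mul Ix Jy).
by apply: ideal_mul_min => // x y /h; apply.
Qed.

Lemma ideal_mulC I J : ideal_mul I J = ideal_mul J I.
Proof.
have h (A B : set R) : ideal_mul A B `<=` ideal_mul B A; last by apply/seteqP; split.
apply: ideal_mul_min => [|x y Ax By]; first exact: ideal_ideal_mul.
by rewrite mulrC; exact: in_mul.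
Qed.

Lemma ideal_mulS I I' J J' : I `<=` I' -> J `<=` J' -> ideal_mul I J `<=` ideal_mul I' J'.
Proof.
move=> II JJ; apply: ideal_mul_min => [|x y Ix Jy]; first exact: ideal_ideal_mul.
by apply: in_mul; [exact: II|exact: JJ].
Qed.

Lemma ideal_mulA I J L : ideal_mul I (ideal_mul J L) = ideal_mul (ideal_mul I J) L.
Proof.
apply/seteqP; split.
  rewrite ideal_mulC; apply/ideal_mul_colon; first exact: ideal_ideal_mul.
  apply: ideal_mul_min => [|x y Jx Ly]; first exact/ideal_colon/ideal_ideal_mul.
  by move=> b Ib; rewrite mulrC mulrA; apply: in_mul => //; exact: in_mul.
apply/ideal_mul_colon; first exact: ideal_ideal_mul.
apply: ideal_mul_min => [|x y Jx Ly]; first exact/ideal_colon/ideal_ideal_mul.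
by move=> b Ib; rewrite -mulrA; apply: in_mul => //; exact: in_mul.
Qed.

Lemma ideal_mulT I : ideal I -> ideal_mul I setT = I.
Proof.
move=> iI; apply/seteqP; split; first by apply: ideal_mul_min => // x y Ix _; exact: idealMR.
by move=> x Ix; rewrite -(mulr1 x); exact: in_mul.
Qed.

Lemma ideal_mul_subr I J : ideal J -> ideal_mul I J `<=` J.
Proof. by move=> iJ; apply: ideal_mul_min => // x y _; exact: idealM. Qed.

Lemma ideal_mul_subl I J : ideal I -> ideal_mul I J `<=` I.
Proof. by move=> iI; apply: ideal_mul_min => // x y Ix _; exact: idealMR. Qed.

Lemma ideal_mul_scale x I J : ideal_mul (scale x I) J = scale x (ideal_mul I J).
Proof.
apply/seteqP; split.
  apply: ideal_mul_min => [|_ y [z Iz <-] Jy]; first exact/ideal_scale/ideal_ideal_mul.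
  by exists (z * y); rewrite ?mulrA //; exact: in_mul.
move=> _ [z IJz <-].
suff : ideal_mul I J `<=` [set z | ideal_mul (scale x I) J (x * z)] by apply.
apply: ideal_mul_min => [|u v Iu Jv /=].
  apply: idealP => /= [|u v|a u].
  - by rewrite mulr0; exact: ideal0 (ideal_ideal_mul _ _).
  - by rewrite mulrDr; exact: idealD (ideal_ideal_mul _ _).
  - by rewrite mulrCA; exact: idealM (ideal_ideal_mul _ _).
by rewrite mulrA; apply: in_mul => //; exists u.
Qed.

Lemma ideal_mul_scaler x I J : ideal_mul I (scale x J) = scale x (ideal_mul I J).
Proof. by rewrite ideal_mulC ideal_mul_scale ideal_mulC. Qed.

Lemma ideal_expS I n : ideal_exp I n.+1 = ideal_mul I (ideal_exp I n).
Proof. by []. Qed.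

Lemma ideal_ideal_exp I n : ideal (ideal_exp I n).
Proof. by case: n => [|n]; [exact: idealT|exact: ideal_ideal_mul]. Qed.

Lemma ideal_exp1 I : ideal I -> ideal_exp I 1 = I.
Proof. exact: ideal_mulT. Qed.

Lemma in_exp I x n : I x -> ideal_exp I n (x ^+ n).
Proof. by move=> Ix; elim: n => // n IH; rewrite exprS; exact: in_mul. Qed.

Lemma ideal_expD I k n : ideal_exp I (k + n) = ideal_mul (ideal_exp I k) (ideal_exp I n).
Proof.
elim: k => [|k IH]; last by rewrite addSn !ideal_expS IH ideal_mulA.
by rewrite ideal_mulC ideal_mulT //; exact: ideal_ideal_exp.
Qed.

Lemma ideal_exp_scale b I n : ideal_exp (scale b I) n = scale (b ^+ n) (ideal_exp I n).
Proof.
elim: n => [|n IH]; first by rewrite expr0 scale1.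
by rewrite !ideal_expS IH ideal_mul_scale ideal_mul_scaler scaleA exprS.
Qed.

Lemma ideal_exp_subS I J n : I `<=` J -> ideal_exp I n `<=` ideal_exp J n.
Proof. by move=> IJ; elim: n => // n IH; exact: ideal_mulS. Qed.

Lemma ideal_exp_sub I n : ideal I -> ideal_exp I n.+1 `<=` I.
Proof. by move=> iI; exact: ideal_mul_subl. Qed.

(** The coefficient ideal is a parameter because, for I generated by [s], [C = setT] describes I and
    [C = m] describes mI, as Nakayama's lemma requires. *)
Fixpoint lincomb (C : set R) (s : seq R) : set R :=
  if s is u :: s' then [set z | exists a y, [/\ C a, lincomb C s' y & z = a * u + y]]
  else [set 0].

Lemma ideal_lincomb C s : ideal C -> ideal (lincomb C s).
Proof.
move=> iC; elim: s => [|u s IH] /=.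
  by split=> // a _ _ -> ->; rewrite /= addr0; exact: mulr0.
split; first by exists 0, 0; rewrite mul0r addr0; split=> //; exact: ideal0.
move=> a _ _ [b [y [Cb hy ->]]] [b' [y' [Cb' hy' ->]]].
exists (a * b + b'), (a * y + y'); split; [exact: iC.2|exact: IH.2|].
have -> : a *: (b * u + y : R^o) = a * (b * u + y) by [].
ring.
Qed.

Lemma lincomb_min s I : ideal I -> (forall u, u \in s -> I u) -> lincomb setT s `<=` I.
Proof.
move=> iI; elim: s => [|u s IH] h /=; first by move=> _ ->; exact: ideal0.
move=> _ [a [y [_ hy ->]]]; apply: idealD => //.
  by apply: idealM => //; apply: h; rewrite inE eqxx.
by apply: IH hy => v vs; apply: h; rewrite inE vs orbT.
Qed.

Lemma lincomb_mem s u : u \in s -> lincomb setT s u.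
Proof.
elim: s => // v s IH; rewrite inE => /orP[/eqP ->|/IH us] /=.
  exists 1, 0; split=> //; last by rewrite mul1r addr0.
  exact: ideal0 (ideal_lincomb s idealT).
by exists 0, u; rewrite mul0r add0r.
Qed.

Lemma generated_lincomb s : @generated R R^o [set x | x \in s] = lincomb setT s.
Proof.
apply/seteqP; split=> z.
  apply; first exact: ideal_lincomb.
  by move=> x; exact: lincomb_mem.
by move=> hz N iN hN; apply: lincomb_min hz.
Qed.

Lemma lincomb_mul C s a y : ideal C -> C a -> lincomb setT s y -> lincomb C s (a * y).
Proof.
move=> iC Ca; elim: s y => [|u s IH] /= y; first by move=> ->; rewrite mulr0.
move=> [b [z [_ hz ->]]]; exists (a * b), (a * z); split; [exact: idealMR|exact: IH|ring].
Qed.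

Definition regular x := forall y, x * y = 0 -> y = 0.

Lemma regularI x y z : regular x -> x * y = x * z -> y = z.
Proof. by move=> rx e; apply/subr0_eq/rx; rewrite mulrBr e subrr. Qed.

Lemma regularM x y : regular x -> regular y -> regular (x * y).
Proof. by move=> rx ry z; rewrite -mulrA => /rx/ry. Qed.

Lemma regularX x n : regular x -> regular (x ^+ n).
Proof.
move=> rx; elim: n => [|n IH]; first by move=> y; rewrite expr0 mul1r.
by rewrite exprS; exact: regularM.
Qed.

Lemma regular_factor x y : regular (x * y) -> regular y.
Proof. by move=> rxy z e; apply: rxy; rewrite -mulrA e mulr0. Qed.

Lemma scaleI x I J : regular x -> scale x I = scale x J -> I = J.
Proof.
move=> rx e; apply/seteqP; split=> y Iy.
  have : scale x J (x * y) by rewrite -e; exists y.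
  by move=> [z Jz /(regularI rx) <-].
have : scale x I (x * y) by rewrite e; exists y.
by move=> [z Jz /(regularI rx) <-].
Qed.

Lemma scale_mem x I y : regular x -> scale x I (x * y) -> I y.
Proof. by move=> rx [z Iz /(regularI rx) <-]. Qed.

Lemma has_length_scale x I J l : regular x -> ideal I -> ideal J -> I `<=` J ->
  @has_length R R^o I J l <-> @has_length R R^o (scale x I) (scale x J) l.
Proof.
move=> rx iI iJ IJ.
apply: (@has_length_transport R R^o R^o (fun y => x * y)) => //.
- by move=> a u v; rewrite mulrDr; congr (_ + _); exact: mulrCA.
- exact: ideal_scale.
- exact: ideal_scale.
- exact: scaleS.
- by move=> v Jv; exists v.
- by move=> v Jv; split=> [|Iv]; [exact: scale_mem|exists v].
- by move=> _ [v Jv <-]; exists v => //; rewrite subrr; exact: ideal0 (ideal_scale x iI).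
Qed.

Definition cofinite I := exists l, colength I l.
(* The junk value 0 is taken at ideals of infinite colength. *)
Definition colen I : nat := xget 0%N [set l | colength I l].

Lemma colenP I : cofinite I -> colength I (colen I).
Proof. by move=> [l hl]; rewrite /colen; case: xgetP => // h; case: (h l). Qed.

Lemma colen_eq I l : colength I l -> colen I = l.
Proof. by move=> h; have cI : cofinite I by [exists l]; exact: has_length_uniq (colenP cI) h. Qed.

Lemma colengthT : colength (setT : set R) 0. Proof. exact: (@has_length0 R R^o). Qed.
Lemma cofiniteT : cofinite setT. Proof. by exists 0%N; exact: colengthT. Qed.
Lemma colenT : colen setT = 0%N. Proof. exact/colen_eq/colengthT. Qed.

Lemma cofinite_split I J : ideal I -> ideal J -> I `<=` J -> cofinite I ->
  [/\ cofinite J, (colen J <= colen I)%N & @has_length R R^o I J (colen I - colen J)].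
Proof.
move=> iI iJ IJ /colenP h.
have [a [b [ha hb e]]] := has_length_split iI iJ idealT IJ (subsetT J) h.
split; first by exists b.
  by rewrite (colen_eq hb) e leq_addl.
by rewrite (colen_eq hb) e addnK.
Qed.

Lemma cofiniteS I J : ideal I -> ideal J -> I `<=` J -> cofinite I -> cofinite J.
Proof. by move=> iI iJ IJ cI; have [] := cofinite_split iI iJ IJ cI. Qed.

Lemma colenS I J : ideal I -> ideal J -> I `<=` J -> cofinite I -> (colen J <= colen I)%N.
Proof. by move=> iI iJ IJ cI; have [] := cofinite_split iI iJ IJ cI. Qed.

Lemma cofinite_ext I J l : ideal I -> ideal J -> I `<=` J -> cofinite J ->
  @has_length R R^o I J l -> cofinite I /\ colen I = (l + colen J)%N.
Proof.
move=> iI iJ IJ /colenP hJ hl.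
have h : colength I (l + colen J).
  by apply: (has_length_add (P := J : set R^o)) => //; exact: subsetT.
by split; [exists (l + colen J)%N|exact: colen_eq].
Qed.

Lemma colen_inj I J : ideal I -> ideal J -> I `<=` J -> cofinite I ->
  (colen I <= colen J)%N -> I = J.
Proof.
move=> iI iJ IJ cI le; have [cJ _] := cofinite_split iI iJ IJ cI.
have -> : (colen I - colen J = 0)%N by lia.
exact: (@has_length0_eq R R^o).
Qed.

Lemma colen0 I : ideal I -> cofinite I -> colen I = 0%N -> I = setT.
Proof.
by move=> iI cI e; apply: colen_inj => //; rewrite e.
Qed.

Lemma colen_scale x I : regular x -> ideal I -> cofinite (scale x setT) -> cofinite I ->
  cofinite (scale x I) /\ colen (scale x I) = (colen (scale x setT) + colen I)%N.
Proof.
move=> rx iI cx /colenP hI; rewrite addnC.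
apply: cofinite_ext => //; try exact: ideal_scale.
  exact: scaleS (@subsetT _ _).
exact/(has_length_scale _ rx iI idealT (@subsetT _ _)).
Qed.

End Ideals.
Arguments idealT {R}.
Arguments cofiniteT {R}.

(** * Noetherian local rings: Nakayama's lemma and socle elements *)

Section LocalRing.
Local Open Scope classical_set_scope.
Local Open Scope ring_scope.
Variables (R : comNzRingType) (m : set R).
Hypotheses (noethR : noetherian R) (localR : local_ring m).
Implicit Types (I J L N : set R) (x y a b : R).

(** Otherwise a choice of strictly larger members gives a strictly increasing sequence in [F]; its
    union is generated by finitely many elements, which already lie in one term. *)
Lemma noetherian_max (F : set (set R)) : (forall I, F I -> ideal I) -> F !=set0 ->
  exists I, F I /\ forall J, F J -> I `<=` J -> J = I.
Proof.
move=> Fi [I0 FI0]; apply: contrapT => nmax.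
have : forall I, exists J, F I -> F J /\ I `<` J.
  move=> I; case: (pselect (F I)) => FI; last by exists I.
  apply: contrapT => nJ; apply: nmax; exists I; split=> // J FJ IJ.
  apply: contrapT => ne; apply: nJ; exists J => _; split=> //; split=> // JI.
  by apply: ne; apply/seteqP.
move=> /choice[g hg]; pose c n := iter n g I0.
have Fc n : F (c n) by elim: n => // n IH; exact: (hg _ IH).1.
have cS n : c n `<` c n.+1 by exact: (hg _ (Fc n)).2.
have cle n k : (n <= k)%N -> c n `<=` c k.
  move=> /subnKC <-; elim: (k - n)%N => [|d IH]; first by rewrite addn0.
  by apply: subset_trans IH _; rewrite addnS; exact: (cS _).1.
pose U := [set x | exists n, c n x].
have iU : ideal U.
  split; first by exists 0%N; exact: ideal0 (Fi _ (Fc 0%N)).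
  move=> a x y [n hx] [k hy]; exists (maxn n k).
  apply: (Fi _ (Fc _)).2; [exact: cle (leq_maxl _ _) _ hx|exact: cle (leq_maxr _ _) _ hy].
have [s] := noethR iU; rewrite /generates generated_lincomb => es.
have [k hk] : exists k, forall u, u \in s -> c k u.
  have : forall u, u \in s -> U u by move=> u us; rewrite -es; exact: lincomb_mem.
  elim: (s) => [|u s' IH] hs; first by exists 0%N.
  have [|k hk] := IH; first by move=> v vs; apply: hs; rewrite inE vs orbT.
  have [n hn] := hs u (mem_head _ _); exists (maxn n k) => v.
  rewrite inE => /orP[/eqP ->|/hk]; first exact: cle (leq_maxl _ _) _ hn.
  by apply: cle; exact: leq_maxr.
apply: (cS k).2 => x hx; have : U x by exists k.+1.
by rewrite -es; apply: lincomb_min => //; exact/Fi.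
Qed.

Let im : ideal m. Proof. by case: localR => -[]. Qed.
Let m1 : ~ m 1. Proof. by case: localR => -[]. Qed.

Lemma proper_sub_max I : ideal I -> ~ I 1 -> I `<=` m.
Proof.
move=> iI I1; pose F := [set J | [/\ ideal J, ~ J 1 & I `<=` J]].
have [||J [[iJ J1 IJ] maxJ]] := @noetherian_max F.
- by move=> J [].
- by exists I; split.
suff -> : m = J by [].
symmetry; apply: localR.2; split=> // L iL L1 JL; apply: maxJ => //; split=> //.
exact: subset_trans JL.
Qed.

Lemma local_unit a : ~ m a -> exists b, a * b = 1.
Proof.
move=> ma; apply: contrapT => nb; apply: ma; apply: proper_sub_max (scaleT a).
  exact: ideal_scale.
by move=> [b _ e]; apply: nb; exists b.
Qed.

Lemma local_unit1B a : m a -> exists b, (1 - a) * b = 1.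
Proof.
by move=> ma; apply: local_unit => h; apply: m1; rewrite -(subrK a 1); exact: idealD.
Qed.

Lemma ideal_unit I a y : ideal I -> ~ m a -> I (a * y) -> I y.
Proof.
move=> iI /local_unit[b e] h; have -> : y = b * (a * y) by rewrite mulrA (mulrC b) e mul1r.
exact: idealM.
Qed.

Lemma max_prime : prime_ideal m.
Proof.
split=> // x y mxy; case: (pselect (m x)); first by left.
by move=> nx; right; apply: ideal_unit nx mxy.
Qed.

(** Induction on the generators, without determinants: as 1 - a is a unit, the first generator is
    expressed by the others modulo [N] and substituted into their relations. *)
Lemma nakayama I N : ideal I -> ideal N -> I `<=` add_ideal (ideal_mul m I) N -> I `<=` N.
Proof.
move=> iI iN h; have [s] := noethR iI; rewrite /generates generated_lincomb => es.
have {}h u : u \in s -> exists y n, [/\ lincomb m s y, N n & u = y + n].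
  move=> us; have [|y [n [hy Nn ->]]] := h u; first by rewrite -es; exact: lincomb_mem.
  exists y, n; split=> //; move: hy; apply: ideal_mul_min; first exact: ideal_lincomb.
  by move=> a b ma; rewrite -es; exact: lincomb_mul.
rewrite -es; apply: lincomb_min => //.
elim: s h {es} => // u s IH h.
have [_ [n [[a [y [ma hy ->]]] Nn e]]] := h u (mem_head _ _).
have [b eb] := local_unit1B ma.
have eu : u = b * y + b * n.
  by rewrite -mulrDr -(mulr1 u) -eb; move: e; rewrite -addrA => /(canLR (addKr _)) <-; ring.
have {}IH : forall v, v \in s -> N v.
  apply: IH => v vs; have [_ [n' [[a' [y' [ma' hy' ->]]] Nn' ->]]] := h v (mem_behead (s := u :: s) vs).
  exists (a' * b * y + y'), (a' * (b * n) + n'); split.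
  - by apply: idealD => //; [exact: ideal_lincomb|apply: idealM => //; exact: ideal_lincomb].
  - by apply: idealD => //; do 2!apply: idealM => //.
  - by rewrite eu; ring.
move=> v; rewrite inE => /orP[/eqP ->|]; last exact: IH.
rewrite eu; apply: idealD => //; apply: idealM => //.
suff /(_ y hy) : lincomb m s `<=` N by [].
elim: (s) IH => [|w s' IH'] hs /=; first by move=> _ ->; exact: ideal0.
move=> _ [c [z [mc hz ->]]]; apply: idealD => //; first by apply: idealM => //; apply: hs; exact: mem_head.
by apply: IH' => // k ks; apply: hs; rewrite inE ks orbT.
Qed.

Lemma nakayama0 I N : ideal I -> ideal N -> I `<=` ideal_mul m I -> I `<=` N.
Proof.
move=> iI iN h; apply: nakayama => //; apply: subset_trans h _; exact: add_ideall.
Qed.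

Lemma colength_m : colength m 1.
Proof.
split.
  exists (fun i => if i == 0%N then m else setT); split.
    by move=> i _; case: ifP => _; split.
  move=> i; rewrite ltnS leqn0 => /eqP -> /=; split; first exact: subsetT.
  by move=> /(_ 1 Logic.I).
move=> k c [h1 h2]; rewrite leqNgt; apply/negP => hk.
have [i1 mc1 _] := h1 1%N (ltnW hk); have [i2 mc2 _] := h1 2%N hk.
have [_ mc0 _] := h1 0%N (leq0n _).
have [c12 n21] := h2 1%N hk; have [c01 n10] := h2 0%N (ltnW hk).
apply: n21 => x _; case: (pselect (c 1%N 1)) => [c1|/(proper_sub_max i1) c1m].
  by rewrite -(mulr1 x); exact: idealM.
by case: n10 => z /c1m/mc0.
Qed.

Lemma cofinite_m : cofinite m. Proof. by exists 1%N; exact: colength_m. Qed.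
Lemma colen_m : colen m = 1%N. Proof. exact/colen_eq/colength_m. Qed.

Definition adjoin N u : set R := add_ideal N (scale u setT).

Lemma ideal_adjoin N u : ideal N -> ideal (adjoin N u).
Proof. by move=> iN; apply: ideal_add => //; exact: ideal_scale. Qed.
Lemma adjoinl N u : N `<=` adjoin N u.
Proof. by apply: add_ideall; exact: ideal_scale. Qed.
Lemma adjoinr N u : ideal N -> adjoin N u u.
Proof. by move=> iN; apply: add_idealr => //; exact: scaleT. Qed.
Lemma adjoin_min N u L : ideal L -> N `<=` L -> L u -> adjoin N u `<=` L.
Proof. by move=> iL NL Lu; apply: add_ideal_min => //; exact: scaleT_min. Qed.
Lemma adjoinP N u z : adjoin N u z <-> exists n b, N n /\ z = n + b * u.
Proof.
split=> [[n [_ [Nn [b _ <-] ->]]]|[n [b [Nn ->]]]]; first by exists n, b; rewrite mulrC.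
by exists n, (b * u); split=> //; exists b; rewrite // mulrC.
Qed.

(** Multiplication by [u] induces an isomorphism of R/m onto (N + uR)/N: a unit in its kernel would
    put [u] in [N]. *)
Lemma has_length_adjoin N u : ideal N -> ~ N u -> (forall a, m a -> N (a * u)) ->
  @has_length R R^o N (adjoin N u) 1.
Proof.
move=> iN Nu mu.
apply/(@has_length_transport R R^o R^o (fun a => a * u) m setT); try exact: colength_m; rewrite //.
- by move=> a b c; rewrite mulrDl; congr (_ + _); rewrite -[a *: b]/(a * b) -mulrA.
- exact: ideal_adjoin.
- exact: adjoinl.
- by move=> v _; apply/adjoinP; exists 0, v; rewrite add0r; split=> //; exact: ideal0.
- move=> v _; split=> [h|]; last exact: mu.
  by apply: contrapT => nv; apply: Nu; exact: ideal_unit nv h.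
- by move=> w /adjoinP[n [b [Nn ->]]]; exists b => //; rewrite addrK.
Qed.

Lemma colen_adjoin N u : ideal N -> cofinite N -> ~ N u -> (forall a, m a -> N (a * u)) ->
  colen N = (colen (adjoin N u)).+1.
Proof.
move=> iN cN Nu mu; have iA := ideal_adjoin u iN.
have NA := @adjoinl N u.
exact: (cofinite_ext iN iA NA (cofiniteS iN iA NA cN) (has_length_adjoin iN Nu mu)).2.
Qed.

Lemma colen_adjoin_le N u : ideal N -> cofinite N -> (forall a, m a -> N (a * u)) ->
  (colen N <= (colen (adjoin N u)).+1)%N.
Proof.
move=> iN cN mu; case: (pselect (N u)) => Nu; last by rewrite -colen_adjoin.
suff <- : N = adjoin N u by [].
by apply/seteqP; split; [exact: adjoinl|exact: adjoin_min].
Qed.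

(** Induction on l(L/N). If a in [m] moves v outside [N], then [L] is replaced by N + avR. This is
    strictly smaller, since it misses v: from v = n + bav it follows that (1 - ba)v lies in [N], and
    1 - ba is a unit. *)
Lemma socle_step N L : ideal N -> ideal L -> cofinite N -> N `<=` L -> N <> L ->
  exists u, [/\ L u, ~ N u & forall a, m a -> N (a * u)].
Proof.
move=> iN; move: {2}(colen N - colen L)%N (leqnn (colen N - colen L)) => d.
elim: d L => [|d IH] L hd iL cN NL ne.
  by case: ne; apply: colen_inj => //; lia.
have [v [Lv Nv]] : exists v, L v /\ ~ N v.
  apply: contrapT => h; apply: ne; apply/seteqP; split=> // v Lv.
  by apply: contrapT => Nv; apply: h; exists v.
case: (pselect (forall a, m a -> N (a * v))) => [h|]; first by exists v.
move=> /existsNP[a /not_implyP[ma nav]].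
have iA := ideal_adjoin (a * v) iN.
have AL : adjoin N (a * v) `<=` L by apply: adjoin_min => //; exact: idealM.
have Av : ~ adjoin N (a * v) v.
  move=> /adjoinP[n [b [Nn e]]]; apply: Nv.
  have [c ec] := local_unit1B (idealM b im ma).
  have en : n = v - b * (a * v) by rewrite {1}e addrK.
  have -> : v = c * n by rewrite en -{1}(mulr1 v) -ec; ring.
  exact: idealM.
have lt : (colen L < colen (adjoin N (a * v)))%N.
  rewrite ltnNge; apply/negP => le; apply: Av.
  rewrite (colen_inj iA iL AL _ le) //; apply: (cofiniteS _ _ _ cN) => //; exact: adjoinl.
have [|||u [Au Nu mu]] := IH (adjoin N (a * v)) _ iA cN.
- have := colenS iA iL AL; have := colenS iN iA (@adjoinl _ _) cN; lia.
- exact: adjoinl.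
- by move=> e; apply: nav; rewrite e; exact: adjoinr.
by exists u; split=> //; exact: AL.
Qed.

(** Induction on the colength: for u in the socle of R/I, a power of [x] in I + uR enters [I] after
    one more factor [x]. *)
Lemma cofinite_pow I x : ideal I -> cofinite I -> m x -> exists k, I (x ^+ k).
Proof.
move=> iI; move: {2}(colen I) (leqnn (colen I)) => d; elim: d I iI => [|d IH] I iI hd cI mx.
  by exists 0%N; rewrite (colen0 iI cI) //; lia.
case: (pselect (I = setT)) => [->|ne]; first by exists 0%N.
have [u [_ Iu mu]] := socle_step iI idealT cI (@subsetT _ _) ne.
have iA := ideal_adjoin u iI.
have [|||k /adjoinP[n [b [In e]]]] := IH _ iA => //.
- by have := colen_adjoin iI cI Iu mu; lia.
- by apply: (cofiniteS _ _ _ cI) => //; exact: adjoinl.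
exists k.+1; rewrite exprS e mulrDr; apply: idealD => //; first exact: idealM.
by rewrite mulrCA; apply: idealM => //; exact: mu.
Qed.

(** * The minimal number of generators as the length of N/mN *)

Section Generators.
Variable N : set R.
Hypotheses (iN : ideal N) (cmN : cofinite (ideal_mul m N)).

Let sub_mN : ideal_mul m N `<=` N. Proof. exact: ideal_mul_subr. Qed.

Lemma colen_mul_le_size s : @generates R R^o N s -> (colen (ideal_mul m N) <= colen N + size s)%N.
Proof.
rewrite /generates generated_lincomb => es.
have sN u : u \in s -> N u by move=> us; rewrite -es; exact: lincomb_mem.
have imN := @ideal_ideal_mul R m N.
have -> : colen N = colen (add_ideal (ideal_mul m N) (lincomb setT s)).
  congr colen; apply/seteqP; split; first by rewrite -{1}es; exact: add_idealr.
  by apply: add_ideal_min => //; exact: lincomb_min.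
elim: s sN {es} => [|u s IH] sN.
  rewrite addn0; suff <- : ideal_mul m N = add_ideal (ideal_mul m N) (lincomb setT [::]) by [].
  by apply/seteqP; split=> [x hx|_ [x [_ [hx -> ->]]]]; [exists x, 0|]; rewrite addr0.
have {}IH := IH (fun v vs => sN v (mem_behead (s := u :: s) vs)).
apply: leq_trans IH _; rewrite addnS -addSn leq_add2r.
have iB : ideal (add_ideal (ideal_mul m N) (lincomb setT s)).
  by apply: ideal_add => //; exact: ideal_lincomb.
have -> : add_ideal (ideal_mul m N) (lincomb setT (u :: s)) =
          adjoin (add_ideal (ideal_mul m N) (lincomb setT s)) u.
  apply/seteqP; split=> [_ [x [_ [hx [a [y [_ hy ->]]] ->]]]|z /adjoinP[_ [b [[x [y [hx hy ->]]] ->]]]].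
    by apply/adjoinP; exists (x + y), a; split; [exists x, y|ring].
  by exists x, (b * u + y); split=> //; [exists b, y|ring].
have iL := @ideal_lincomb R setT s idealT.
apply: colen_adjoin_le => //; first by apply: (cofiniteS _ _ _ cmN) => //; exact: add_ideall.
by move=> a ma; apply: add_ideall => //; apply: in_mul => //; apply: sN; exact: mem_head.
Qed.

(** Climbing from mN to N by socle elements costs one generator per unit of length; Nakayama's lemma
    then discards mN. The induction runs over all ideals [P] between the two. *)
Lemma generates_colen : exists2 s, @generates R R^o N s & size s = (colen (ideal_mul m N) - colen N)%N.
Proof.
have imN := @ideal_ideal_mul R m N.
suff h P : ideal P -> ideal_mul m N `<=` P -> P `<=` N ->
    exists2 s, add_ideal P (lincomb setT s) = N & size s = (colen P - colen N)%N.
  have [s es sz] := h _ imN (@subset_refl _ _) sub_mN.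
  exists s => //; rewrite /generates generated_lincomb; apply/seteqP; split.
    rewrite -es; apply: add_idealr => //.
  apply: nakayama => //; first exact: ideal_lincomb.
  by rewrite es.
move=> iP mP PN; move: {2}(colen P) (leqnn (colen P)) => d.
elim: d P iP mP PN => [|d IH] P iP mP PN hd;
  have cP : cofinite P by [exact: (cofiniteS _ _ _ cmN)].
  have eP : P = N by apply: colen_inj => //; lia.
  by exists [::]; rewrite eP ?subnn //=; apply/seteqP; split=> [_ [x [_ [hx -> ->]]]|x hx];
    [rewrite addr0|exists x, 0; rewrite addr0].
case: (pselect (P = N)) => [->|ne].
  by exists [::]; rewrite ?subnn //=; apply/seteqP; split=> [_ [x [_ [hx -> ->]]]|x hx];
    [rewrite addr0|exists x, 0; rewrite addr0].
have [u [Nu Pu mu]] := socle_step iP iN cP PN ne.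
have iA := ideal_adjoin u iP.
have AN : adjoin P u `<=` N by exact: adjoin_min.
have eA := colen_adjoin iP cP Pu mu.
have [|||s es sz] := IH _ iA => //.
- exact: subset_trans (@adjoinl _ _).
- by lia.
exists (u :: s).
  rewrite -es; apply/seteqP; split=> [_ [x [_ [hx [a [y [_ hy ->]]] ->]]]|
      _ [_ [y [/adjoinP[x [b [hx ->]]] hy ->]]]].
    by exists (x + a * u), y; split=> //; [apply/adjoinP; exists x, a|ring].
  by exists x, (b * u + y); split=> //; [exists b, y|ring].
have := colenS iA iN AN (cofiniteS iP iA (@adjoinl _ _) cP).
by rewrite /= sz eA; lia.
Qed.

Lemma min_num_gens_colen n : @min_num_gens R R^o N n <-> n = (colen (ideal_mul m N) - colen N)%N.
Proof.
have [s gs sz] := generates_colen.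
have lb t : @generates R R^o N t -> (colen (ideal_mul m N) - colen N <= size t)%N.
  by move=> /colen_mul_le_size; lia.
split=> [[[t gt <-] h]|->]; last by split=> //; exists s.
by have := h _ gs; have := lb _ gt; lia.
Qed.

End Generators.

(** * Regular elements in dimension one have finite colength *)

Section DimensionOne.
Hypothesis dimR : krull_dim R 1.

(* An ideal maximal among those avoiding the elements s y^n, with s outside p,
   is a prime contained in p. *)
Lemma prime_below p y : prime_ideal p -> p y -> regular y -> exists2 q, prime_ideal q & q `<` p.
Proof.
move=> [ip p1 pp] py ry.
pose S := [set z | exists s n, ~ p s /\ z = s * y ^+ n].
pose F := [set J | ideal J /\ J `&` S = set0].
have [||q [[iq qS] maxq]] := @noetherian_max F.
- by move=> J [].
- exists [set 0]; split; first exact: (@ideal_lincomb R setT [::] idealT).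
  apply/seteqP; split=> // z [-> [s [n [ps]]]].
  by rewrite mulrC => /esym/(regularX ry) s0; apply: ps; rewrite s0; exact: ideal0.
have qp z : q z -> p z.
  move=> qz; apply: contrapT => npz; have : (q `&` S) z; last by rewrite qS.
  by split=> //; exists z, 0%N; rewrite expr0 mulr1.
have meet a : ~ q a -> exists z, S z /\ adjoin q a z.
  move=> nqa; apply: contrapT => h; apply: nqa.
  rewrite -(maxq (adjoin q a)); [exact: adjoinr| |exact: adjoinl].
  split; first exact: ideal_adjoin.
  by apply/seteqP; split=> // z [h1 h2]; apply: h; exists z.
exists q; last first.
  split=> // /(_ y py) qy; have : (q `&` S) y; last by rewrite qS.
  by split=> //; exists 1, 1%N; rewrite expr1 mul1r.
split=> //.
  by move=> q1; apply: p1; exact: qp.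
move=> a b qab; case: (pselect (q a)); first by left.
move=> /meet[_ [[s [n [ps ->]]] /adjoinP[u [c [qu eu]]]]].
case: (pselect (q b)); first by right.
move=> /meet[_ [[t [k [pt ->]]] /adjoinP[v [d [qv ev]]]]].
have : (q `&` S) ((s * y ^+ n) * (t * y ^+ k)); last by rewrite qS.
split.
  rewrite eu ev.
  have -> : (u + c * a) * (v + d * b) = (v + d * b) * u + ((c * a) * v + (c * d) * (a * b)) by ring.
  by apply: idealD => //; [exact: idealM|apply: idealD => //; exact: idealM].
exists (s * t), (n + k)%N; split; first by case/pp.
by rewrite exprD; ring.
Qed.

(* An ideal maximal among those of infinite colength is prime. *)
Lemma cofinite_regular y : regular y -> cofinite (scale y setT).
Proof.
move=> ry; apply: contrapT => ncy.
pose F := [set J | [/\ ideal J, J y & ~ cofinite J]].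
have [||p [[ip py ncp] maxp]] := @noetherian_max F.
- by move=> J [].
- by exists (scale y setT); split=> //; [exact: ideal_scale|exact: scaleT].
have big J : ideal J -> p `<=` J -> J <> p -> cofinite J.
  by move=> iJ pJ ne; apply: contrapT => nc; apply: ne; apply: maxp => //; split=> //; exact: pJ.
have p1 : ~ p 1 by move=> /(ideal1 ip) e; apply: ncp; rewrite e; exact: cofiniteT.
have pp : prime_ideal p.
  split=> // a b pab; apply: contrapT => /not_orP[na nb]; apply: ncp.
  have iA := ideal_adjoin a ip.
  have cA : cofinite (adjoin p a).
    by apply: big => //; [exact: adjoinl|move=> e; apply: na; rewrite -e; exact: adjoinr].
  pose Q := colon p [set a]; have iQ : ideal Q by exact: ideal_colon.
  have cQ : cofinite Q.
    apply: big => //; first exact: colon_sub.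
    by move=> e; apply: nb; rewrite -e => _ ->; rewrite mulrC.
  (* Since (p + aR)/p is isomorphic to R/(p : a), finite colength of both larger ideals would give
     it to [p]. *)
  suff hl : @has_length R R^o p (adjoin p a) (colen Q).
    exact: (cofinite_ext ip iA (@adjoinl _ _) cA hl).1.
  apply/(@has_length_transport R R^o R^o (fun r => r * a) Q setT); try exact: colenP; rewrite //.
  - by move=> r b' c; rewrite mulrDl; congr (_ + _); rewrite -[r *: b']/(r * b') -mulrA.
  - exact: adjoinl.
  - by move=> v _; apply/adjoinP; exists 0, v; rewrite add0r; split=> //; exact: ideal0.
  - by move=> v _; split=> [h _ ->|]; [|apply].
  - by move=> w /adjoinP[n [c [Nn ->]]]; exists c => //; rewrite addrK.
(* Together with a prime below [p] this is a chain of three primes, against dimension one. *)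
have pm : p `<` m.
  split; first exact: proper_sub_max.
  by move=> mp; apply: ncp; apply: (cofiniteS _ _ _ cofinite_m).
have [q pq qp] := prime_below pp py ry.
have : (2 <= 1)%N; last by [].
apply: (dimR.2 2%N (fun i => if i == 0%N then q else if i == 1%N then p else m)); split.
  by move=> i _; case: ifP => // _; case: ifP => // _; exact: max_prime.
by move=> [|[|//]] _.
Qed.

End DimensionOne.

End LocalRing.

(** * First extension module of the residue field *)

Section Ext.
Local Open Scope classical_set_scope.
Local Open Scope ring_scope.
Variables (R : comNzRingType) (m : set R) (C : lmodType R) (x : R).
Hypotheses (im : ideal m) (mx : m x) (xC : forall c : C, x *: c = 0 -> c = 0).

Definition multiples : set C := [set c | exists c', c = x *: c'].
(** This is (xC : m), the preimage in [C] of the socle of C/xC. *)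
Definition socle_multiples : set C := [set c | forall a, m a -> multiples (a *: c)].

Lemma submodule_multiples : submodule multiples.
Proof.
split; first by exists 0; rewrite scaler0.
move=> a _ _ [c ->] [c' ->]; exists (a *: c + c').
by rewrite scalerDr !scalerA mulrC.
Qed.

Lemma submodule_socle_multiples : submodule socle_multiples.
Proof.
split; first by move=> a _; rewrite scaler0; exact: submodule_multiples.1.
move=> a c c' hc hc' b mb; rewrite scalerDr scalerA mulrC -scalerA.
by apply: submodule_multiples.2; [exact: hc|exact: hc'].
Qed.

Definition pairing q (v : 'rV[R]_q) (f : {ffun 'I_q -> C}) : C := \sum_k v 0 k *: f k.

Lemma pairing_linl q a (u v : 'rV[R]_q) f :
  pairing (a *: u + v) f = a *: pairing u f + pairing v f.
Proof.
rewrite /pairing scaler_sumr -big_split /=; apply: eq_bigr => k _.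
by rewrite !mxE scalerDl scalerA.
Qed.

Lemma pairing_linr q a (u : 'rV[R]_q) f g :
  pairing u (a *: f + g) = a *: pairing u f + pairing u g.
Proof.
rewrite /pairing scaler_sumr -big_split /=; apply: eq_bigr => k _.
by rewrite !ffunE scalerDr !scalerA mulrC.
Qed.

Lemma pairing0l q f : pairing (0 : 'rV[R]_q) f = 0.
Proof. by rewrite /pairing big1 // => k _; rewrite mxE scale0r. Qed.

Lemma pairingZl q a (u : 'rV[R]_q) f : pairing (a *: u) f = a *: pairing u f.
Proof. by rewrite -[a *: u]addr0 pairing_linl pairing0l addr0. Qed.

Lemma pairingDl q (u v : 'rV[R]_q) f : pairing (u + v) f = pairing u f + pairing v f.
Proof. by rewrite -[u]scale1r pairing_linl !scale1r. Qed.

Lemma pairingBl q (u v : 'rV[R]_q) f : pairing (u - v) f = pairing u f - pairing v f.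
Proof. by rewrite -!scaleN1r pairingDl pairingZl. Qed.

Lemma pairing_suml q (I : finType) (a : I -> R) (u : I -> 'rV[R]_q) f :
  pairing (\sum_i a i *: u i) f = \sum_i a i *: pairing (u i) f.
Proof.
rewrite /pairing; under [RHS]eq_bigr do rewrite scaler_sumr.
rewrite exchange_big /=; apply: eq_bigr => k _.
by rewrite summxE scaler_suml; apply: eq_bigr => i _; rewrite mxE scalerA.
Qed.

Lemma pairing_delta q j f : pairing (delta_mx 0 j : 'rV[R]_q) f = f j.
Proof.
rewrite /pairing (bigD1 j) //= big1 ?addr0 ?mxE ?eqxx ?scale1r // => k nk.
by rewrite mxE (negbTE nk) andbF scale0r.
Qed.

Lemma pairing_hom_map p q (D : 'M[R]_(q, p)) w f :
  pairing w (hom_map D f) = pairing (w *m D) f.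
Proof.
rewrite /pairing; under eq_bigr do rewrite ffunE scaler_sumr.
rewrite exchange_big /=; apply: eq_bigr => k _.
by rewrite mxE scaler_suml; apply: eq_bigr => i _; rewrite scalerA.
Qed.

Lemma hom_map_row p q (D : 'M[R]_(q, p)) f j : hom_map D f j = pairing (row j D) f.
Proof. by rewrite ffunE; apply: eq_bigr => k _; rewrite mxE. Qed.

Lemma hom_map_linear p q (D : 'M[R]_(q, p)) a f g :
  hom_map D (a *: f + g) = a *: hom_map D f + hom_map D g :> {ffun 'I_q -> C}.
Proof.
apply/ffunP => j; rewrite hom_map_row pairing_linr -!hom_map_row.
by rewrite [in RHS]ffunE [in RHS]ffunE.
Qed.

Lemma hom_map0 p q (D : 'M[R]_(q, p)) : hom_map D (0 : {ffun 'I_p -> C}) = 0.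
Proof.
have := hom_map_linear D 1 0 0; rewrite !scale1r !addr0 => e.
by apply: (addrI (hom_map D 0)); rewrite addr0 -e.
Qed.

Variables (n : nat -> nat) (eps : {linear 'rV[R]_(n 0%N) -> R^o})
  (d : forall i, 'M[R]_(n i.+1, n i)).
Hypothesis res : @free_resolution R R^o m n eps d.

(* Pairing with w, where x v0 = w d_0 and v0 lifts 1, maps H^1 of the complex
   Hom(R^n, C) isomorphically onto (xC : m) / xC. *)
Lemma ext1_length l :
  has_length (@coboundaries R C n d 1) (@cocycles R C n d 1) l <->
  has_length multiples socle_multiples l.
Proof.
have [surj ex0 exS] := res.
have [v0 hv0] := surj 1.
have lift a : m a -> exists w, a *: v0 = w *m d 0%N.
  move=> ma; apply/ex0; rewrite linearZ_LR; exact: (@idealMR R m (eps v0) a im ma).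
have [w hw] := lift x mx.
(* The value of a cocycle at [v] thus depends only on the syzygy [v *m d 0]: cocycles are the linear
   maps from the first syzygies of R/m to [C]. *)
have ker v f : @cocycles R C n d 1 f -> v *m d 0%N = 0 -> pairing v f = 0.
  move=> hf /exS[u ->]; rewrite -pairing_hom_map hf.
  by rewrite /pairing big1 // => k _; rewrite ffunE scaler0.
apply: (has_length_transport (f := pairing w)).
- by move=> a u v; rewrite pairing_linr.
- split; first exact: hom_map0.
  by move=> a f g; rewrite /cocycles /= hom_map_linear => -> ->; rewrite scaler0 addr0.
- exact: submodule_multiples.
- exact: submodule_socle_multiples.
- move=> _ [g _ <-]; apply/ffunP => j; rewrite hom_map_row pairing_hom_map.
  have -> : row j (d 1%N) *m d 0%N = 0.
    by apply/exS; exists (delta_mx 0 j); rewrite rowE.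
  by rewrite pairing0l ffunE.
- by move=> c [c' ->] a _; rewrite scalerA mulrC -scalerA; exists (a *: c').
- move=> f hf a ma; have [w' hw'] := lift a ma; exists (pairing w' f).
  apply/subr0_eq; rewrite -!pairingZl -pairingBl; apply: ker => //.
  by rewrite mulmxBl -!scalemxAl -hw -hw' !scalerA mulrC subrr.
- move=> f hf; split; last first.
    move=> [g _ <-]; rewrite pairing_hom_map -hw; exists (pairing v0 g).
    exact: pairingZl.
  move=> [c hc].
  have /choice[r hr] : forall k, exists u, (delta_mx 0 k : 'rV[R]_(n 0%N)) - eps (delta_mx 0 k) *: v0 = u *m d 0%N.
    move=> k; apply/ex0; rewrite linearB linearZ_LR.
    set e := eps _; have -> : e - e *: eps v0 = e * (1 - eps v0 : R) :> R by rewrite mulrBr mulr1.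
    exact: idealM.
  (* This extends [f] from the syzygies to the free module. A basis vector is [eps] of it times
     [v0], plus a syzygy; and [v0] must go to [c], because x v0 is the syzygy [w *m d 0], where [f]
     takes the value xc. *)
  exists [ffun k => pairing (r k) f + eps (delta_mx 0 k) *: c] => //.
  apply/ffunP => j; rewrite ffunE; apply/subr0_eq/xC.
  pose D := d 0%N; pose rho : R := \sum_k D j k *: eps (delta_mx 0 k).
  pose S := \sum_k D j k *: r k.
  have -> : \sum_k D j k *: [ffun k0 => pairing (r k0) f + eps (delta_mx 0 k0) *: c] k
     = pairing S f + rho *: c.
    rewrite pairing_suml scaler_suml -big_split /=; apply: eq_bigr => k _.
    by rewrite ffunE scalerDr scalerA.
  rewrite scalerBr scalerDr scalerA mulrC -scalerA -hc.
  rewrite -(pairing_delta j f) -!pairingZl -pairingDl -pairingBl.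
  apply: ker => //; rewrite mulmxBl mulmxDl -!scalemxAl -hw.
  have -> : S *m d 0%N = row j D - rho *: v0.
    rewrite mulmx_suml [row j D]row_sum_delta scaler_suml -sumrB; apply: eq_bigr => k _.
    by rewrite -scalemxAl -hr scalerBr scalerA mxE.
  by rewrite -rowE scalerBr !scalerA (mulrC rho) subrK subrr.
- move=> c hc.
  have mD j : m (eps (row j (d 0%N))) by apply/ex0; exists (delta_mx 0 j); rewrite rowE.
  (* The cocycle sought sends a syzygy z to eps(z)c/x: the division is possible because eps(z) lies
     in [m], and unique because [x] is injective on [C]. *)
  have /choice[f hf] : forall j, exists c', eps (row j (d 0%N)) *: c = x *: c'.
    by move=> j; exact: hc.
  have key v : x *: pairing v (finfun f) = eps (v *m d 0%N) *: c.
    rewrite /pairing scaler_sumr mulmx_sum_row linear_sum scaler_suml.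
    apply: eq_bigr => k _; rewrite ffunE scalerA mulrC -scalerA -hf scalerA.
    by rewrite linearZ_LR.
  exists (finfun f).
    apply/ffunP => j; rewrite hom_map_row ffunE; apply: xC; rewrite key.
    have -> : row j (d 1%N) *m d 0%N = 0.
      by apply/exS; exists (delta_mx 0 j); rewrite rowE.
    by rewrite linear0 scale0r.
  have -> : pairing w (finfun f) = (eps v0 : R) *: c.
    apply/subr0_eq/xC; rewrite scalerBr key -hw linearZ_LR scalerA; exact: subrr.
  by rewrite -{1}(scale1r c) -scalerBl; exact: hc.
Qed.

End Ext.

(** * Faithfulness of modules of finite injective dimension *)

Section SubmoduleType.
Local Open Scope classical_set_scope.
Local Open Scope ring_scope.
Variables (R : comNzRingType) (M : lmodType R) (N : set M).

(** Injectivity is tested on module types, so a submodule has to become one. The proof of closure is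
    an argument so that the closure instance can be attached to the predicate. *)
Definition submodule_pred of submodule N : {pred M} := fun x => `[< N x >].
Variable sN : submodule N.

Fact submodule_pred_closed : submod_closed (submodule_pred sN).
Proof.
split; first by apply/asboolP; exact: submodule0.
by move=> a u v /asboolP Nu /asboolP Nv; apply/asboolP; exact: sN.2.
Qed.
HB.instance Definition _ :=
  GRing.isSubmodClosed.Build R M (submodule_pred sN) submodule_pred_closed.

Record submodule_type := Submodule_type
  { submodule_val :> M; submodule_valP : submodule_val \in submodule_pred sN }.
HB.instance Definition _ := [isSub for submodule_val].
HB.instance Definition _ := [Choice of submodule_type by <:].
HB.instance Definition _ := [SubChoice_isSubLmodule of submodule_type by <:].

End SubmoduleType.

Section Faithful.
Local Open Scope classical_set_scope.
Local Open Scope ring_scope.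
Variable R : comNzRingType.

(** Baer's criterion for a partial linear map given by its graph. The graph itself is the source of
    the extension problem, with its two projections as embedding and map, and [e] is the image of
    1. *)
Lemma injective_graph (E : lmodType R) (G : set (R^o * E)%type) :
  injective_module E -> submodule G -> (forall v, G (0, v) -> v = 0) ->
  exists e, forall a v, G (a, v) -> v = a *: e.
Proof.
move=> injE sG fG.
pose A := submodule_type sG.
pose j : A -> R^o := fun u => (val u).1.
pose f : A -> E := fun u => (val u).2.
have jl : linear j by move=> a u v; rewrite /j linearP.
have fl : linear f by move=> a u v; rewrite /f linearP.
pose Hj := GRing.isLinear.Build _ _ _ _ j jl.
pose Hf := GRing.isLinear.Build _ _ _ _ f fl.
pose j' : {linear A -> R^o} := HB.pack j Hj.
pose f' : {linear A -> E} := HB.pack f Hf.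
have ij : injective j'.
  move=> u v e; apply/subr0_eq/val_inj; rewrite linearB /=.
  have h : G (val u - val v).
    by apply: submoduleB => //; apply/asboolP; exact: submodule_valP.
  have e1 : (val u - val v).1 = 0 by rewrite /=; apply/subr0_eq; rewrite subr0; apply/eqP; rewrite subr_eq0; exact/eqP.
  move: h e1; case: (val u - val v) => r s /= h e1; rewrite e1 in h *.
  by rewrite (fG _ h).
have [g hg] := injE _ _ j' f' ij.
exists (g 1) => a v Gav.
have hin : (a, v) \in submodule_pred sG by exact/asboolP.
have /= := hg (Submodule_type hin); rewrite /f /= => <-.
by rewrite /j /= -linearZ_LR; congr (g _); exact/esym/mulr1.
Qed.

Lemma injective_divisible (E : lmodType R) (x : R) (e : E) :
  injective_module E -> regular x -> exists e', e = x *: e'.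
Proof.
move=> injE rx; pose G := [set z : R^o * E | exists b : R, z = (b * x, b *: e)].
have [||e' he'] := @injective_graph E G injE.
- split; first by exists 0; rewrite mul0r scale0r.
  move=> a _ _ [b ->] [b' ->]; exists (a * b + b'); congr (_, _) => /=.
    by rewrite mulrDl -mulrA.
  by rewrite scalerDl scalerA.
- by move=> v [b [e0 ->]]; rewrite [b]rx ?scale0r // mulrC -e0.
by exists e'; apply: he'; exists 1; rewrite mul1r scale1r.
Qed.

Variable m : set R.
Hypotheses (noethR : noetherian R) (localR : local_ring m).
Variables (C : lmodType R) (E : nat -> lmodType R) (eps : {linear C -> E 0%N})
  (d : forall i, {linear E i -> E i.+1}) (n : nat).
Hypotheses (injE : forall i, injective_module (E i)) (inj_eps : injective eps)
  (exact0 : forall x, d 0%N x = 0 <-> exists c, x = eps c)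
  (exactS : forall i x, d i.+1 x = 0 <-> exists y, x = d i y)
  (E0 : forall i, (n < i)%N -> forall x : E i, x = 0).
Variables (x w : R).
Hypotheses (rx : regular x) (cx : cofinite (scale x setT)) (mx : m x).
Hypotheses (nw : ~ scale x setT w) (mw : forall a, m a -> scale x setT (a * w)).

Let im : ideal m. Proof. by case: localR => -[]. Qed.
Let dd i y : d i.+1 (d i y) = 0. Proof. by apply/exactS; exists y. Qed.

(* Surjectivity of (0 :_(E i+1) J) -> (0 :_Z J), where Z is the image of d_(i+1);
   this says that Ext^(i+2)(R/J, C) = 0. *)
Definition ext_vanishing i := forall J, ideal J -> J x -> forall s : E i.+2,
  (exists y, s = d i.+1 y) -> (forall a, J a -> a *: s = 0) ->
  exists g, (forall a, J a -> a *: g = 0) /\ d i.+1 g = s.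

(** The map cx + bw -> bs is well defined, because bw in xR forces b into [m]. It extends to some t0
    with x t0 = 0 and w t0 = s. The image of t0 under [d] is killed by (x, w), so the vanishing
    hypothesis corrects t0 to a cocycle. *)
Let socle_cocycle i (s : E i.+1) : ext_vanishing i -> d i.+1 s = 0 ->
  (forall a, m a -> a *: s = 0) ->
  exists t, [/\ d i.+1 t = 0, x *: t = 0 & w *: t = s].
Proof.
move=> Pi ds ms.
have unitb b c : c * x + b * w = 0 -> m b.
  move=> e; apply: contrapT => nb; apply: nw.
  apply: (ideal_unit noethR localR _ nb); first exact: ideal_scale.
  by exists (- c) => //; rewrite mulrN mulrC; apply/eqP; rewrite eq_sym -addr_eq0 addrC e.
pose G := [set z : R^o * E i.+1 | exists c b : R, z = (c * x + b * w, b *: s)].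
have [||t0 ht0] := @injective_graph _ G (@injE i.+1).
- split; first by exists 0, 0; rewrite !mul0r scale0r addr0.
  move=> a _ _ [c [b ->]] [c' [b' ->]]; exists (a * c + c'), (a * b + b'); congr (_, _) => /=.
    by rewrite -[a *: _]/(a * _); ring.
  by rewrite scalerDl scalerA.
- by move=> v [c [b [e0 ->]]]; apply/ms/(unitb b c).
have xt0 : x *: t0 = 0 by apply/esym/ht0; exists 1, 0; rewrite mul1r mul0r addr0 scale0r.
have wt0 : w *: t0 = s by apply/esym/ht0; exists 0, 1; rewrite mul1r mul0r add0r scale1r.
pose J := [set z | exists c b, z = c * x + b * w].
have iJ : ideal J.
  split; first by exists 0, 0; rewrite !mul0r addr0.
  move=> a _ _ [c [b ->]] [c' [b' ->]]; exists (a * c + c'), (a * b + b').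
  by rewrite -[a *: _]/(a * _); ring.
have [|||g [Jg dg]] := Pi J iJ _ (d i.+1 t0).
- by exists 1, 0; rewrite mul1r mul0r addr0.
- by exists t0.
- move=> _ [c [b ->]]; rewrite -linearZ_LR scalerDl -!scalerA xt0 wt0.
  by rewrite scaler0 add0r linearZ_LR ds scaler0.
have xg : x *: g = 0 by apply: Jg; exists 1, 0; rewrite mul1r mul0r addr0.
have wg : w *: g = 0 by apply: Jg; exists 0, 1; rewrite mul1r mul0r add0r.
exists (t0 - g); split.
- by rewrite linearB dg subrr.
- by rewrite scalerBr xt0 xg subrr.
- by rewrite scalerBr wt0 wg subr0.
Qed.

(** Induction on the colength of [J], along R/m -> R/J -> R/(J + uR) for a socle element u. A lift
    of us killed by [m] extends to g0 killed by [J]; then s - d(g0) is killed by J + uR. *)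
Let ext_vanishing_max i :
  (forall s : E i.+2, (exists y, s = d i.+1 y) -> (forall a, m a -> a *: s = 0) ->
    exists g, (forall a, m a -> a *: g = 0) /\ d i.+1 g = s) ->
  ext_vanishing i.
Proof.
move=> Pm J iJ; move: {2}(colen J) (leqnn (colen J)) => k.
elim: k J iJ => [|k IH] J iJ hk Jx s [y sy] Js.
  have cJ : cofinite J.
    by apply: (cofiniteS _ iJ (scaleT_min iJ Jx) cx); exact: ideal_scale.
  have J1 : J 1 by rewrite (colen0 iJ cJ) //; lia.
  by exists 0; rewrite linear0 -[s]scale1r Js //; split=> // a _; rewrite scaler0.
have cJ : cofinite J.
  by apply: (cofiniteS _ iJ (scaleT_min iJ Jx) cx); exact: ideal_scale.
case: (pselect (J = setT)) => [eJ|neJ].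
  have J1 : J 1 by rewrite eJ.
  by exists 0; rewrite linear0 -[s]scale1r Js //; split=> // a _; rewrite scaler0.
have [u [_ Ju mu]] := socle_step noethR localR iJ idealT cJ (@subsetT _ _) neJ.
have [||h [mh dh]] := Pm (u *: s).
- by exists (u *: y); rewrite sy linearZ_LR.
- by move=> a ma; rewrite scalerA Js //; exact: mu.
pose G := [set z : R^o * E i.+1 | exists j b : R, J j /\ z = (j + b * u, b *: h)].
have [||g0 hg0] := @injective_graph _ G (@injE i.+1).
- split; first by exists 0, 0; split; [exact: ideal0|rewrite !mul0r scale0r addr0].
  move=> a _ _ [c [b [Jc ->]]] [c' [b' [Jc' ->]]].
  exists (a * c + c'), (a * b + b'); split; first exact: iJ.2.
  congr (_, _) => /=; last by rewrite scalerDl scalerA.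
  by rewrite -[a *: _]/(a * _); ring.
- move=> v [c [b [Jc [e0 ->]]]]; apply: mh; apply: contrapT => nb; apply: Ju.
  apply: (ideal_unit noethR localR iJ nb).
  have -> : b * u = - c by apply/eqP; rewrite -addr_eq0 addrC -e0.
  exact: idealN.
have Jg0 a : J a -> a *: g0 = 0.
  by move=> Ja; apply/esym/hg0; exists a, 0; rewrite mul0r addr0 scale0r.
have ug0 : u *: g0 = h.
  by apply/esym/hg0; exists 0, 1; rewrite mul1r add0r scale1r; split=> //; exact: ideal0.
have iA := ideal_adjoin u iJ.
have [||||g1 [Jg1 dg1]] := IH (adjoin J u) iA _ _ (s - d i.+1 g0).
- by have := colen_adjoin noethR localR iJ cJ Ju mu; lia.
- exact: adjoinl.
- by exists (y - g0); rewrite linearB sy.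
- move=> a /adjoinP[j [b [Jj ->]]]; rewrite scalerBr -linearZ_LR !scalerDl.
  by rewrite Js // Jg0 // !add0r -!scalerA ug0 linearZ_LR dh subrr.
exists (g0 + g1); split.
  by move=> a Ja; rewrite scalerDr Jg0 // Jg1 ?addr0 //; exact: adjoinl.
by rewrite linearD dg1 addrC subrK.
Qed.

(** Descending induction from the end of the resolution. A socle cocycle is s = wt with xt = 0 and t
    = d(u). Then xu is a cocycle d(v); as v is divisible by x, subtracting a coboundary from u gives
    u' with xu' = 0. Now wu' lifts s, and [m] kills it because mw lies in xR. *)
Lemma ext_vanishing_all i : ext_vanishing i.
Proof.
move: {2}(n - i)%N (leqnn (n - i)) => k; elim: k i => [|k IH] i hk.
  move=> J iJ Jx s _ _; exists 0; split; first by move=> a _; rewrite scaler0.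
  by rewrite linear0 [s]E0 //; lia.
case: (leqP n i) => hin.
  move=> J iJ Jx s _ _; exists 0; split; first by move=> a _; rewrite scaler0.
  by rewrite linear0 [s]E0 //; lia.
apply: ext_vanishing_max => s [y sy] ms.
have [||t [dt xt wt]] := socle_cocycle (IH i.+1 _) _ ms.
- by lia.
- by rewrite sy dd.
have /exactS[u tu] := dt.
have /exactS[v xuv] : d i.+1 (x *: u) = 0 by rewrite linearZ_LR -tu.
have [v' vv'] := injective_divisible v (@injE i) rx.
have xu' : x *: (u - d i v') = 0 by rewrite scalerBr xuv vv' linearZ_LR subrr.
exists (w *: (u - d i v')); split.
  move=> a /mw[c _ e]; rewrite scalerA -e mulrC -scalerA xu' scaler0 //.
by rewrite linearZ_LR linearB dd subr0 -tu.
Qed.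

(** In [E 0] let xy = eps(c). The cocycle d(y) is killed by [m], hence equals w d(u) with x d(u) =
    0, so xu = eps(e) and wu - y = eps(c''). If we = 0, multiplication by x gives c = -xc'', against
    the choice of c. *)
Lemma socle_not_annihilator (c : C) : (forall c : C, x *: c = 0 -> c = 0) ->
  (forall a, m a -> multiples x (a *: c)) -> ~ multiples x c ->
  exists e : C, w *: e != 0.
Proof.
move=> xC mc nc.
pose G := [set z : R^o * E 0%N | exists c', [/\ m z.1, x *: c' = (z.1 : R) *: c & z.2 = eps c']].
have [||y hy] := @injective_graph _ G (@injE 0%N).
- split; first by exists 0; split; [exact: ideal0|rewrite scaler0; exact: esym (scale0r c)|exact: esym (linear0 eps)].
  move=> a [r v] [r' v'] [c1 [/= mr e1 ->]] [c2 [/= mr' e2 ->]].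
  exists (a *: c1 + c2); split=> /=; [exact: im.2| |by rewrite linearP].
  by rewrite scalerDr scalerDl e2 scalerA mulrC -scalerA e1 scalerA.
- by move=> v [c' [/= _ e ->]]; rewrite [c']xC ?linear0 // e scale0r.
have xy : x *: y = eps c by apply/esym/hy; exists c.
have [||t [dt xt wt]] := @socle_cocycle 0%N (d 0%N y) (@ext_vanishing_all 0%N).
- exact: dd.
- move=> a ma; have [c' e] := mc a ma.
  rewrite -linearZ_LR -(hy a (eps c')); last by exists c'.
  by apply/exact0; exists c'.
have /exactS[u tu] := dt.
have /exact0[e xue] : d 0%N (x *: u) = 0 by rewrite linearZ_LR -tu.
have /exact0[c'' wuy] : d 0%N (w *: u - y) = 0 by rewrite linearB linearZ_LR -tu wt subrr.
exists e; apply/eqP => we0; apply: nc; exists (- c''); apply: inj_eps.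
rewrite -xy scalerN linearN linearZ_LR -wuy scalerBr scalerA mulrC -scalerA xue.
by rewrite -linearZ_LR we0 linear0 sub0r opprK.
Qed.

End Faithful.

(** * Canonical ideals *)

Section Canonical.
Local Open Scope classical_set_scope.
Local Open Scope ring_scope.
Variables (R : comNzRingType) (m : set R).
Hypotheses (noethR : noetherian R) (localR : local_ring m).
Implicit Types (I J K L N A B : set R) (x y a b c : R).

Let im : ideal m. Proof. by case: localR => -[]. Qed.
Let m1 : ~ m 1. Proof. by case: localR => -[]. Qed.

Lemma krull_dim_uniq d d' : krull_dim R d -> krull_dim R d' -> d = d'.
Proof.
move=> [[c hc] hd] [[c' hc'] hd']; apply/eqP.
by rewrite eqn_leq (hd _ _ hc') (hd' _ _ hc).
Qed.

Lemma depth_uniq (C : lmodType R) d d' : depth m C d -> depth m C d' -> d = d'.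
Proof.
move=> [[s [h1 h2 <-]] hd] [[s' [h1' h2' <-]] hd']; apply/eqP.
by rewrite eqn_leq hd' ?hd.
Qed.

Lemma exists_regular : krull_dim R 1 -> cohen_macaulay m -> exists2 x, m x & regular x.
Proof.
move=> dimR [d [/(krull_dim_uniq dimR) <-]] [[[|x [|y s]] [hm [hr _] //] _] _].
exists x; first by apply: hm; exact: mem_head.
move=> y xy0; have := hr 0%N isT y; rewrite /= -[x *: _]/(x * y) xy0 => h.
have : @seq_mul R [::] R^o y.
  by apply: h => N sN _; exact: sN.1.
by move=> /(_ [set 0]); apply; [exact: (@ideal_lincomb R setT [::] idealT)|move=> z []].
Qed.

Definition socle_of x I : set R := [set c | I c /\ forall a, m a -> scale x I (a * c)].
Definition simple_socle I := forall x, m x -> regular x ->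
  @has_length R R^o (scale x I) (socle_of x I) 1.

Lemma ideal_socle_of x I : ideal I -> ideal (socle_of x I).
Proof.
move=> iI; split; first by split=> [|a _]; rewrite ?mulr0; apply: ideal0 => //; exact: ideal_scale.
move=> a u v [Iu hu] [Iv hv]; split=> [|b mb]; first exact: iI.2.
have -> : b * (a *: (u : R^o) + v) = a * (b * u) + b * v by rewrite -[a *: _]/(a * _); ring.
by apply: idealD; [exact: ideal_scale|apply: idealM; [exact: ideal_scale|exact: hu]|exact: hv].
Qed.

Lemma scale_sub_socle x I : ideal I -> scale x I `<=` socle_of x I.
Proof.
move=> iI z hz; split=> [|a _]; first exact: scale_sub hz.
by apply: idealM => //; exact: ideal_scale.
Qed.

Lemma has_length_multiples (C : lmodType R) (f : {linear C -> R^o}) x l :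
  injective f ->
  has_length (@multiples R C x) (@socle_multiples R m C x) l <->
  @has_length R R^o (scale x (range f)) (socle_of x (range f)) l.
Proof.
move=> injf.
have iI : ideal (range f).
  split; first by exists 0; rewrite ?linear0.
  by move=> a _ _ [u _ <-] [v _ <-]; exists (a *: u + v); rewrite ?linearP.
have scaleE (c : C) : scale x (range f) (f c) <-> multiples x c.
  split=> [[_ [c' _ <-] e]|[c' ->]]; last by exists (f c'); [exists c'|rewrite linearZ_LR].
  by exists c'; apply: injf; rewrite linearZ_LR.
apply: (has_length_transport (f := f)).
- by move=> a u v; rewrite linearP.
- exact: submodule_socle_multiples.
- exact: ideal_scale.
- exact: ideal_socle_of.
- by move=> c [c' ->] a _; exists (a *: c'); rewrite !scalerA mulrC.
- exact: scale_sub_socle.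
- move=> v hv; split=> [|a ma]; first by exists v.
  by rewrite -[a * _]/(a *: (f v)) -linearZ_LR; apply/scaleE/hv.
- by move=> v _; exact: scaleE.
- move=> _ [[v _ <-] hv]; exists v; last by rewrite subrr; exact: ideal0 (ideal_scale x iI).
  by move=> a ma; apply/scaleE; rewrite linearZ_LR; exact: hv.
Qed.

Lemma canonical_ideal_ideal I : canonical_ideal m I -> ideal I.
Proof.
move=> [C [_ [f [_ <-]]]].
split; first by exists 0; rewrite ?linear0.
by move=> a _ _ [u _ <-] [v _ <-]; exists (a *: u + v); rewrite ?linearP.
Qed.

Lemma canonical_simple_socle I : krull_dim R 1 -> canonical_ideal m I -> simple_socle I.
Proof.
move=> dimR [C [[_ [d [hd dC]] [d' [dC' [n [eps [D [res hl]]]]] _] [f [injf <-]]]]] x mx rx.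
rewrite -(depth_uniq dC dC') -(krull_dim_uniq dimR hd) in hl.
have xC (c : C) : x *: c = 0 -> c = 0.
  move=> e; apply: injf; rewrite linear0; apply: rx.
  by rewrite -[x * _]/(x *: (f c)) -linearZ_LR e linear0.
by apply/(has_length_multiples x 1 injf)/(ext1_length im mx xC res).
Qed.

Lemma cm_type_socle r x : m x -> regular x -> cm_type_dim1 m r ->
  @has_length R R^o (scale x setT) (socle_of x setT) r.
Proof.
move=> mx rx [n [eps [D [res hl]]]].
have xR (c : R^o) : x *: c = 0 -> c = 0 by exact: rx.
move: hl => /(ext1_length im mx xR res) hl.
have eT : range (idfun : R -> R) = setT.
  by apply/seteqP; split=> // z _; exists z.
have := has_length_multiples (f := (idfun : {linear R^o -> R^o})) x r (fun _ _ => id).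
by rewrite eT => <-.
Qed.

(** [ext_length] demands a free resolution of R/m; the one supplied with the canonical module serves
    here too. *)
Lemma cm_type_exists I r x : canonical_ideal m I -> m x -> regular x ->
  @has_length R R^o (scale x setT) (socle_of x setT) r -> cm_type_dim1 m r.
Proof.
move=> [C [[_ _ [d' [_ [n [eps [D [res _]]]]]] _] _]] mx rx hl.
exists n, eps, D; split=> //.
have xR (c : R^o) : x *: c = 0 -> c = 0 by exact: rx.
apply/(ext1_length im mx xR res).
have eT : range (idfun : R -> R) = setT.
  by apply/seteqP; split=> // z _; exists z.
have := has_length_multiples (f := (idfun : {linear R^o -> R^o})) x r (fun _ _ => id).
by rewrite eT => ->.
Qed.

Lemma has_length_strict I J l : has_length (I : set R^o) J l.+1 -> ideal I -> I `<=` J ->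
  exists u, J u /\ ~ I u.
Proof.
move=> hl iI IJ; apply: contrapT => h.
have e : I = J.
  by apply/seteqP; split=> // u Ju; apply: contrapT => nI; apply: h; exists u.
have := has_length_uniq (has_length0 iI); rewrite {2}e => /(_ _ hl) //.
Qed.

(** If the annihilator of [I] were not inside xR, it would contain a nonzero socle element of R/xR
    modulo xR, against [socle_not_annihilator]. Inside xR it equals x times itself, as [x] is
    regular, and Nakayama's lemma applies. *)
Lemma canonical_faithful I x z : krull_dim R 1 -> canonical_ideal m I -> m x -> regular x ->
  (forall c, I c -> z * c = 0) -> z = 0.
Proof.
move=> dimR canI mx rx hz.
have iI := canonical_ideal_ideal canI.
have cx := cofinite_regular noethR localR dimR rx.
have ix := ideal_scale x (@idealT R).
have hs := canonical_simple_socle dimR canI mx rx.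
pose ann : set R := colon [set 0] I.
have iann : ideal ann by apply: ideal_colon; exact: (@ideal_lincomb R setT [::] idealT).
suff sub : ann `<=` scale x ann.
  have : ann z by exact: hz.
  suff /(_ z) h : ann `<=` [set 0] by exact: h.
  apply: (nakayama0 noethR localR) => //; first exact: (@ideal_lincomb R setT [::] idealT).
  by move=> u /sub[v av <-]; exact: in_mul.
move=> u au; suff [v _ e] : scale x setT u.
  by exists v => // c /au h; apply: rx; rewrite mulrA e.
apply: contrapT => nu.
have iA := ideal_adjoin u ix.
have [|v [/adjoinP[_ [b [[t _ <-] ev]] nv mv]]] :=
  socle_step noethR localR ix iA cx (@adjoinl _ _ _).
  by move=> e; apply: nu; rewrite e; exact: adjoinr.
pose w := b * u.
have nw : ~ scale x setT w by move=> h; apply: nv; rewrite ev; apply: idealD => //; exists t.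
have mw a : m a -> scale x setT (a * w).
  move=> ma; have -> : a * w = a * v - x * (a * t) by rewrite ev /w; ring.
  by apply: idealB => //; [exact: mv|exists (a * t)].
move: canI => [C [[_ _ _ [E [eps [d [n [injE inj_eps ex0 exS E0]]]]]] [f [injf fI]]]].
have xC (c : C) : x *: c = 0 -> c = 0.
  move=> e; apply: injf; rewrite linear0; apply: rx.
  by rewrite -[x * _]/(x *: (f c)) -linearZ_LR e linear0.
have [s [[Is ms] ns]] := has_length_strict hs (ideal_scale x iI) (scale_sub_socle iI).
move: Is ms ns.
rewrite -fI => -[c _ <-] hc nc.
have [|||e] := socle_not_annihilator noethR localR injE inj_eps ex0 exS E0 rx cx mx nw mw (c := c) => //.
- move=> a /hc [_ [c' _ <-]]; rewrite -[a * _]/(a *: (f c)) -[x * _]/(x *: (f c')) -!linearZ_LR.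
  by move=> /injf <-; exists c'.
- by move=> [c' e]; apply: nc; exists (f c'); [exists c'|rewrite e linearZ_LR].
move=> /eqP; apply; apply: injf; rewrite linear0 linearZ_LR.
have : I (f e) by rewrite -fI; exists e.
by move=> /au h; rewrite -[_ *: _]/(b * u * f e) -mulrA h mulr0.
Qed.

(** * Duality of lengths in K/yK *)

Section Duality.
Variable K : set R.
Hypotheses (iK : ideal K) (cK : cofinite K) (sK : simple_socle K).

(** Modulo yK, [B = K] gives Hom(R/A, K/yK); [B = setT] gives (yK : A), the annihilator of A/yK when
    A contains yK. One definition serves both directions of the duality. *)
Definition dual y B A : set R := B `&` colon (scale y K) A.

Lemma ideal_dual y A B : ideal B -> ideal (dual y B A).
Proof.
move=> iB; apply: (@submoduleI R R^o) => //; apply: ideal_colon; exact: ideal_scale.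
Qed.

Section FixedElement.
Variable y : R.
Hypotheses (my : m y) (ry : regular y) (cy : cofinite (scale y setT)).

Let iyK : ideal (scale y K). Proof. exact: ideal_scale. Qed.
Let cyK : cofinite (scale y K). Proof. by have [] := colen_scale ry iK cy cK. Qed.
Let colen_yK : colen (scale y K) = (colen (scale y setT) + colen K)%N.
Proof. by have [] := colen_scale ry iK cy cK. Qed.

Lemma dual_sub_scale A B : scale y K `<=` B -> scale y K `<=` dual y B A.
Proof. by move=> hB z hz; split; [exact: hB|exact: colon_sub]. Qed.

Lemma cofinite_dual A B : ideal B -> scale y K `<=` B -> cofinite (dual y B A).
Proof.
move=> iB hB; apply: (cofiniteS iyK _ _ cyK); [exact: ideal_dual|exact: dual_sub_scale].
Qed.

Lemma socle_generator s t : socle_of y K s -> ~ scale y K s -> socle_of y K t ->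
  exists b, scale y K (t - b * s).
Proof.
move=> hs ns ht.
have iS := ideal_socle_of y iK; have sub := @scale_sub_socle y _ iK.
have cs : cofinite (socle_of y K) by apply: (cofiniteS _ _ _ cyK).
have [_ e1] := cofinite_ext iyK iS sub cs (sK my ry).
have e2 := colen_adjoin noethR localR iyK cyK ns hs.2.
have iA := ideal_adjoin s iyK.
have e : adjoin (scale y K) s = socle_of y K.
  apply: colen_inj => //; [exact: adjoin_min|by apply: (cofiniteS _ _ (@adjoinl _ _ _) cyK)|lia].
by move: ht; rewrite -e => /adjoinP[n [b [hn ->]]]; exists b; rewrite addrK.
Qed.

(** Multiplication by [u] maps the dual of [A] into the simple socle of K/yK, and its kernel modulo
    yK is the dual of A + uR. *)
Lemma colen_dual_adjoin A B u : ideal A -> ideal B -> scale y K `<=` B ->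
  (forall b, B b -> K (u * b)) -> (forall a, m a -> A (a * u)) ->
  (colen (dual y B (adjoin A u)) <= (colen (dual y B A)).+1)%N.
Proof.
move=> iA iB hB uB mu.
have iD := ideal_dual y A iB; have iD' := ideal_dual y (adjoin A u) iB.
have sub : dual y B (adjoin A u) `<=` dual y B A.
  by move=> b [Bb hb]; split=> // a Aa; apply: hb; exact: adjoinl.
case: (pselect (dual y B A `<=` dual y B (adjoin A u))) => [h|].
  by suff -> : dual y B (adjoin A u) = dual y B A by []; apply/seteqP.
move=> /existsNP[b0 /not_implyP[D0 nD0]].
have mulD b : dual y B A b -> forall a, m a -> scale y K (a * u * b).
  by move=> [Bb hb] a ma; rewrite mulrC; apply: hb; exact: mu.
have inD b : B b -> dual y B A b -> scale y K (u * b) -> dual y B (adjoin A u) b.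
  move=> Bb [_ hb] hub; split=> // _ /adjoinP[a [c [Aa ->]]].
  by rewrite mulrDr; apply: idealD => //; [exact: hb|rewrite mulrCA (mulrC b); exact: idealM].
have soc b : dual y B A b -> socle_of y K (u * b).
  by move=> Db; split; [exact: uB Db.1|move=> a ma; rewrite mulrA; exact: mulD].
have n0 : ~ scale y K (u * b0) by move=> h; apply: nD0; apply: inD => //; exact: D0.1.
have eD : dual y B A = adjoin (dual y B (adjoin A u)) b0.
  apply/seteqP; split; last exact: adjoin_min.
  move=> b Db; have [c hc] := socle_generator (soc _ D0) n0 (soc _ Db).
  apply/adjoinP; exists (b - c * b0), c; rewrite subrK; split=> //.
  have Dbc : dual y B A (b - c * b0) by apply: idealB => //; exact: idealM.
  apply: inD => //; first exact: Dbc.1.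
  by have -> : u * (b - c * b0) = u * b - c * (u * b0) by ring.
rewrite {1}eD; apply: (colen_adjoin_le noethR localR) => //; first exact: cofinite_dual.
move=> a ma; apply: inD.
- by apply: idealM => //; exact: D0.1.
- exact: idealM.
- by rewrite mulrCA mulrA; exact: mulD.
Qed.

Lemma colen_dual_le A0 A B : ideal A0 -> ideal A -> ideal B -> A0 `<=` A -> cofinite A0 ->
  scale y K `<=` B -> (forall a b, A a -> B b -> K (a * b)) ->
  (colen (dual y B A) + colen A <= colen (dual y B A0) + colen A0)%N.
Proof.
move=> iA0 iA iB A0A cA0 hB hAB.
move: {2}(colen A0) (leqnn (colen A0)) => k.
elim: k A0 iA0 A0A cA0 => [|k IH] A0 iA0 A0A cA0 hk.
  by rewrite (colen_inj iA0 iA A0A cA0) //; lia.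
case: (pselect (A0 = A)) => [->//|ne].
have [u [Au nu mu]] := socle_step noethR localR iA0 iA cA0 A0A ne.
have iA1 := ideal_adjoin u iA0.
have e := colen_adjoin noethR localR iA0 cA0 nu mu.
have := colen_dual_adjoin iA0 iB hB (fun b => hAB u b Au) mu.
have hA : adjoin A0 u `<=` A by exact: adjoin_min.
have cA1 : cofinite (adjoin A0 u) by apply: (cofiniteS _ _ (@adjoinl _ _ _) cA0).
have hk1 : (colen (adjoin A0 u) <= k)%N by lia.
by have := IH _ iA1 hA cA1 hk1; lia.
Qed.

(** Two inequalities, one from yR to [J] and one from [J] to R, squeeze the sum: the dual of yR is
    K, that of R is yK, and both give l(R/yK). *)
Lemma colen_dual J : ideal J -> J y ->
  (colen (dual y K J) + colen J = colen (scale y K))%N.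
Proof.
move=> iJ Jy; have iy := ideal_scale y (@idealT R).
have sub : scale y setT `<=` J by exact: scaleT_min.
have cJ : cofinite J by exact: (cofiniteS _ _ sub cy).
have yKK : scale y K `<=` K by exact: scale_sub.
have eT : dual y K setT = scale y K.
  apply/seteqP; split=> [z [_ /(_ 1 Logic.I)]|]; first by rewrite mulr1.
  exact: dual_sub_scale.
have ey : dual y K (scale y setT) = K.
  apply/seteqP; split=> [z []//|z Kz]; split=> // _ [b _ <-].
  by exists (z * b); [exact: idealMR|ring].
have h1 := colen_dual_le iy iJ iK sub cy yKK (fun a b _ Kb => idealM a iK Kb).
have h2 := colen_dual_le iJ idealT iK (@subsetT _ _) cJ yKK (fun a b _ Kb => idealM a iK Kb).
rewrite eT colenT ey in h1 h2; rewrite colen_yK in h2 *; lia.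
Qed.

(** One inequality comes from the filtration between yK and [N]; the other holds because [N] lies in
    the dual of (yK : N), whose colength [colen_dual] gives. *)
Lemma colen_colon N : ideal N -> scale y K `<=` N -> N `<=` K ->
  (colen (colon (scale y K) N) + colen N = colen (scale y K))%N.
Proof.
move=> iN yN NK.
have e : dual y setT N = colon (scale y K) N by rewrite /dual setTI.
have h1 := colen_dual_le iyK iN idealT yN cyK (@subsetT _ _) (fun a b Na _ => idealMR b iK (NK _ Na)).
have eT : dual y setT (scale y K) = setT.
  by rewrite /dual setTI; apply/seteqP; split=> // a _ b; exact: idealM.
have iC : ideal (colon (scale y K) N) by exact: ideal_colon.
have Cy : colon (scale y K) N y by move=> b /NK; exists b.
have h2 := colen_dual iC Cy.
have h3 : (colen (dual y K (colon (scale y K) N)) <= colen N)%N.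
  apply: colenS => //; [exact: ideal_dual| |by apply: (cofiniteS _ _ _ cyK)].
  by move=> z Nz; split; [exact: NK|move=> a ha; rewrite mulrC; exact: ha].
rewrite eT colenT e in h1; lia.
Qed.

Lemma dual_colon N : ideal N -> scale y K `<=` N -> N `<=` K ->
  dual y K (colon (scale y K) N) = N.
Proof.
move=> iN yN NK.
have iC : ideal (colon (scale y K) N) by exact: ideal_colon.
have Cy : colon (scale y K) N y by move=> b /NK; exists b.
symmetry; apply: colen_inj => //; [exact: ideal_dual| |by apply: (cofiniteS _ _ _ cyK)|].
  by move=> z Nz; split; [exact: NK|move=> a ha; rewrite mulrC; exact: ha].
by have := colen_dual iC Cy; have := colen_colon iN yN NK; lia.
Qed.

(** The endomorphisms of a canonical ideal are the multiplications by ring elements; the smaller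
    side already has the colength computed by [colen_colon]. *)
Lemma colon_scale_self : colon (scale y K) K = scale y setT.
Proof.
have iC : ideal (colon (scale y K) K) by exact: ideal_colon.
symmetry; apply: colen_inj => //.
- exact: ideal_scale.
- by move=> _ [b _ <-] k Kk; exists (b * k); [exact: idealM|ring].
by have := colen_colon iK (scale_sub iK) (@subset_refl _ _); rewrite colen_yK; lia.
Qed.

Lemma colon_scale_max : colon (scale y K) (ideal_mul m K) = colon (scale y setT) m.
Proof.
apply/seteqP; split=> a ha.
  move=> b mb; rewrite -colon_scale_self => k Kk.
  by rewrite -mulrA; apply: ha; exact: in_mul.
suff h : ideal_mul m K `<=` colon (scale y K) [set a].
  by move=> b /h/(_ a erefl); rewrite mulrC.
apply: ideal_mul_min => [|b k mb Kk _ ->]; first exact: ideal_colon.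
have [t _ e] := ha b mb; exists (t * k); first exact: idealM.
by rewrite mulrA e; ring.
Qed.

(** In other terms l((yR : m)/yR) = l(K/mK): the type is the number of generators of K. *)
Lemma colen_type : (colen (colon (scale y setT) m) + colen (ideal_mul m K)
  = colen (scale y setT) + colen K)%N.
Proof.
rewrite -colen_yK -colon_scale_max; apply: colen_colon.
- exact: ideal_ideal_mul.
- by move=> _ [k Kk <-]; exact: in_mul.
- exact: ideal_mul_subr.
Qed.

End FixedElement.

Lemma canonical_endomorphism y a : regular y -> cofinite (scale y setT) ->
  (forall k, K k -> scale y K (a * k)) -> scale y setT a.
Proof.
move=> ry cy h; case: (pselect (m y)) => my; first by rewrite -colon_scale_self.
have [b e] := local_unit noethR localR my.
by exists (b * a); rewrite // mulrA e mul1r.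
Qed.

End Duality.

Lemma cofinite_regular_mem I x : m x -> regular x -> ideal I -> cofinite I ->
  exists2 y, I y & regular y.
Proof.
move=> mx rx iI cI; have [k h] := cofinite_pow noethR localR iI cI mx.
by exists (x ^+ k) => //; exact: regularX.
Qed.

(* The canonical dual of I is cyclic because the socle of I/xI is simple; its
   generator then provides the isomorphism of I with K. *)
Lemma canonical_ideal_uniq I K x : m x -> regular x ->
  (forall y, regular y -> cofinite (scale y setT)) ->
  ideal I -> cofinite I -> simple_socle I -> ideal K -> cofinite K -> simple_socle K ->
  exists a b, [/\ regular a, regular b & scale a I = scale b K].
Proof.
move=> mx rx creg iI cI sI iK cK sK.
have [c Kc rc] := cofinite_regular_mem mx rx iK cK.
have [y0 Iy0 ry0] := cofinite_regular_mem mx rx iI cI.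
(* The factor [c] moves [I] into [K], and [y0] puts yK inside [N]. The factor [x] is taken out again
   below: [z] already lies in [L], so [y] lies in mL and duality applies to mL. *)
pose z := c * y0; pose y := x * z.
have rxc : regular (x * c) by exact: regularM.
have ry : regular y by apply: regularM => //; exact: regularM.
have my : m y by exact: idealMR.
have cy := creg _ ry.
have cIK : scale c I `<=` K by move=> _ [i _ <-]; exact: idealMR.
pose N := scale (x * c) I.
have iN : ideal N by exact: ideal_scale.
have NK : N `<=` K by move=> _ [i Ii <-]; rewrite -mulrA; apply: idealM => //; apply: cIK; exists i.
have yN : scale y K `<=` N.
  by move=> _ [k _ <-]; exists (y0 * k); [exact: idealMR|rewrite /y /z; ring].
have iyK : ideal (scale y K) by exact: ideal_scale.
have [cyK _] := colen_scale ry iK cy cK.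
pose L := colon (scale y K) N.
have iL : ideal L by exact: ideal_colon.
have dL : dual K y K L = N by exact: dual_colon.
have Lz : L z.
  move=> _ [i Ii <-]; exists (c * i); last by rewrite /y; ring.
  by apply: cIK; exists i.
have mLy : ideal_mul m L y by exact: in_mul.
have imL := @ideal_ideal_mul R m L.
have cmL : cofinite (ideal_mul m L).
  by apply: (cofiniteS _ _ (scaleT_min imL mLy) cy) => //; exact: ideal_scale.
have Ly : L y by exact: ideal_mul_subr mLy.
(* The dual of mL consists of the elements of K that [m] multiplies into [N]. It exceeds [N] by one
   simple socle, so L/mL has length 1 and [L] is cyclic. *)
have dmL : dual K y K (ideal_mul m L) = scale c (socle_of x I).
  apply/seteqP; split=> [k [Kk hk]|_ [i [Ii hi] <-]].
    have hN a : m a -> N (a * k).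
      move=> ma; rewrite -dL; split; first exact: idealM.
      by move=> b Lb; have -> : a * k * b = k * (a * b) by [ring]; exact: hk _ (in_mul ma Lb).
    have [i Ii e] := hN x mx.
    have ek : k = c * i by apply: (regularI rx); rewrite -e; ring.
    exists i => //; split=> // a ma; have [j Ij e'] := hN a ma.
    by exists j => //; apply: (regularI rc); rewrite mulrA (mulrC c) e' ek; ring.
  split; first by apply: cIK; exists i.
  have ic : ideal (colon (scale y K) [set c * i]) by exact: ideal_colon.
  suff h : ideal_mul m L `<=` colon (scale y K) [set c * i].
    by move=> b /h/(_ _ erefl); rewrite mulrC.
  apply: ideal_mul_min => // a b ma Lb _ ->.
  have [j Ij e] := hi a ma.
  have -> : a * b * (c * i) = b * (x * c * j) by rewrite -mulrA -(mulrA x) (mulrCA x) e; ring.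
  by apply: Lb; exists j.
have e1 := colen_dual iK cK sK my ry cy iL Ly.
have e2 := colen_dual iK cK sK my ry cy imL mLy.
have hN : @has_length R R^o N (scale c (socle_of x I)) 1.
  rewrite /N mulrC -scaleA.
  apply/(has_length_scale _ rc (ideal_scale x iI) (ideal_socle_of x iI) (@scale_sub_socle x _ iI)).
  exact: sI.
have [g gL] : exists g, L = scale g setT.
  have [s gs sz] := generates_colen noethR localR iL cmL.
  have e3 : (colen N = 1 + colen (scale c (socle_of x I)))%N.
    have iS : ideal (scale c (socle_of x I)) by apply/ideal_scale/ideal_socle_of.
    have NS : N `<=` scale c (socle_of x I).
      rewrite /N mulrC -scaleA; apply: scaleS; exact: scale_sub_socle.
    have cN : cofinite N by exact: (cofiniteS _ _ yN cyK).
    exact: (cofinite_ext iN iS NS (cofiniteS iN iS NS cN) hN).2.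
  rewrite dL in e1; rewrite dmL in e2.
  have s1 : size s = 1%N by rewrite sz; lia.
  case: s s1 gs {sz} => [|g [|]] // _; rewrite /generates generated_lincomb => <-.
  exists g; apply/seteqP; split=> [_ [a [_ [_ -> ->]]]|_ [a _ <-]].
    by exists a; rewrite // addr0 mulrC.
  by exists a, 0; rewrite addr0 mulrC.
have [h _ yh] : scale g setT y by rewrite -gL.
have Lg : L g by rewrite gL; exact: scaleT.
have rg : regular g by apply: (@regular_factor _ h); rewrite mulrC yh.
exists (g * (x * c)), y; split=> //; first exact: regularM.
apply/seteqP; split=> [_ [i Ii <-]|_ [k Kk <-]].
  by rewrite -mulrA; apply: Lg; exists i.
have [i Ii e] : N (h * k).
  rewrite -dL; split; first exact: idealM.
  rewrite gL => _ [b _ <-]; exists (b * k); first exact: idealM.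
  by rewrite -yh; ring.
by exists i => //; rewrite -mulrA e -yh; ring.
Qed.

End Canonical.

(** * Principal reductions *)

Section PrincipalReduction.
Local Open Scope classical_set_scope.
Local Open Scope ring_scope.
Variables (R : comNzRingType) (m : set R).
Hypotheses (noethR : noetherian R) (localR : local_ring m).
Hypothesis infk : infinite_residue_field m.
Hypothesis creg : forall y : R, regular y -> cofinite (scale y setT).
Implicit Types (I J K L N : set R) (x y a b c : R).

Let im : ideal m. Proof. by case: localR => -[]. Qed.
Let m1 : ~ m 1. Proof. by case: localR => -[]. Qed.

(** The bound on roots over R/m, carried out in R: for a root l modulo [m], p - p(l) is divisible by
    X - l, and the quotient takes values in [m] at the elements of [S] not congruent to l. *)
Lemma monic_values_finite (p : {poly R}) (S : set R) : p \is monic ->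
  (forall a, S a -> m p.[a]) -> exists s : seq R, forall a, S a -> exists2 b, b \in s & m (a - b).
Proof.
move: {2}(size p) (erefl (size p)) => n; elim: n p S => [|n IH] p S sp mp hS.
  by have := monic_neq0 mp; rewrite -size_poly_eq0 sp.
case: (pselect (S !=set0)) => [[l Sl]|nS]; last first.
  by exists [::] => a Sa; case: nS; exists a.
case: n IH sp => [|n] IH sp.
  have e : p = 1.
    have := size1_polyC (eq_leq sp); move: mp; rewrite monicE lead_coefE sp /= => /eqP ->.
    by move=> ->.
  by have := hS l Sl; rewrite e hornerC => /m1.
have sc : (size (p.[l]%:P) < size p)%N by rewrite sp (leq_ltn_trans (size_polyC_leq1 _)).
have /factor_theorem[q eq] : root (p - p.[l]%:P) l by rewrite rootE !hornerE subrr.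
have mX := monicXsubC l.
have mq : q \is monic.
  have : p - p.[l]%:P \is monic.
    by rewrite monicE lead_coefDl ?size_polyN // -monicE.
  by rewrite eq monicMr.
have sq : size q = n.+1.
  have : size (p - p.[l]%:P) = n.+2 by rewrite size_polyDl ?size_polyN.
  by rewrite eq size_Mmonic ?monic_neq0 // size_XsubC addn2 => -[].
have [|s hs] := IH q (S `&` [set a | ~ m (a - l)]) sq mq.
  move=> a [Sa nal]; apply: (ideal_unit noethR localR im nal).
  have -> : (a - l) * q.[a] = p.[a] - p.[l].
    have := congr1 (fun r : {poly R} => r.[a]) eq; rewrite hornerM !hornerE => ->; exact: mulrC.
  by apply: idealB => //; exact: hS.
exists (l :: s) => a Sa; case: (pselect (m (a - l))) => h.
  by exists l => //; rewrite mem_head.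
by have [b bs mb] := hs a (conj Sa h); exists b => //; rewrite inE bs orbT.
Qed.

Lemma monic_unit_value (p : {poly R}) : p \is monic -> exists l, ~ m p.[l].
Proof.
move=> mp; apply: contrapT => h; apply: infk.
have [|s hs] := @monic_values_finite p setT mp.
  by move=> a _; apply: contrapT => na; apply: h; exists a.
apply: (@sub_finite_set _ _ [set [set y | m (y - x)] | x in [set` s]]).
  move=> _ [a _ <-]; have [b bs mab] := hs a Logic.I; exists b => //.
  apply/seteqP; split=> y /= hy.
    by have -> : y - a = (y - b) - (a - b) by [ring]; exact: idealB.
  by have -> : y - b = (y - a) + (a - b) by [ring]; exact: idealD.
by apply: finite_image; exact: finite_seq.
Qed.

Lemma ideal_exp_add I c n : ideal I ->
  ideal_exp (adjoin I c) n.+1 `<=`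
  add_ideal (ideal_exp I n.+1) (scale c (ideal_exp (adjoin I c) n)).
Proof.
move=> iI; set J := adjoin I c; have iJ : ideal J by exact: ideal_adjoin.
have iE k := @ideal_ideal_exp R J k.
have iS k : ideal (add_ideal (ideal_exp I k.+1) (scale c (ideal_exp J k))).
  by apply: ideal_add; [exact: ideal_ideal_exp|exact: ideal_scale].
elim: n => [|n IH].
  by rewrite !ideal_exp1 // => z [i [j [Ii hj ->]]]; exists i, j.
rewrite ideal_expS; apply: ideal_mul_min => // x y /adjoinP[i [b [Ii ->]]] hy.
rewrite mulrDl; apply: idealD => //; last first.
  apply: (add_idealr (ideal_ideal_exp I n.+2)).
  by exists (b * y); [exact: idealM (iE _) hy|rewrite mulrCA mulrA].
have [u [_ [hu [v hv <-] ->]]] := IH _ hy.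
rewrite mulrDr; exists (i * u), (i * (c * v)); split=> //; first exact: in_mul.
exists (i * v); last by rewrite mulrCA.
by apply: in_mul => //; exact: adjoinl.
Qed.

(* For n > l(R/aR) the monomials a^i c^(n-i) satisfy, modulo m J^n, a relation
   given by a monic polynomial p; if p(l) is a unit, a - l c generates a
   reduction of J = (a, c). *)
Lemma pair_reduction a c : regular a -> m a -> m c ->
  exists b n, [/\ adjoin (scale a setT) c b, regular b &
    ideal_exp (adjoin (scale a setT) c) n.+1 = scale b (ideal_exp (adjoin (scale a setT) c) n)].
Proof.
move=> ra ma mc; set J := adjoin _ _.
have ia := ideal_scale a (@idealT R).
have iJ : ideal J by exact: ideal_adjoin.
have Ja : J a by apply: adjoinl; exact: scaleT.
have Jc : J c by exact: adjoinr.
have ca := creg ra.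
pose n := (colen (scale a setT)).+1.
pose Q := ideal_exp J n; have iQ : ideal Q by exact: ideal_ideal_exp.
pose mQ := ideal_mul m Q; have imQ : ideal mQ by exact: ideal_ideal_mul.
have cQ : cofinite Q.
  have Qa : Q (a ^+ n) by exact: in_exp.
  have can := creg (regularX (n := n) ra).
  by apply: (cofiniteS _ _ (scaleT_min iQ Qa) can) => //; exact: ideal_scale.
have aQ : scale a Q `<=` mQ by move=> _ [q hq <-]; exact: in_mul.
have [caQ eaQ] := colen_scale ra iQ ca cQ.
have iaQ := ideal_scale a iQ.
have cmQ : cofinite mQ by exact: (cofiniteS _ _ aQ caQ).
have le_mQ := colenS iaQ imQ aQ caQ.
pose v i := a ^+ i * c ^+ (n - i).
have Qv i : (i <= n)%N -> Q (v i).
  by move=> hi; rewrite /Q -(subnKC hi) ideal_expD; apply: in_mul; exact: in_exp.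
pose N j := [set z | exists (g : nat -> R) u, mQ u /\ z = u + \sum_(i < j) g i * v i].
have iN j : ideal (N j).
  split; first by exists (fun=> 0), 0; rewrite big1 ?addr0 // => [|i _]; [split=> //; exact: ideal0|rewrite mul0r].
  move=> r _ _ [g [u [hu ->]]] [g' [u' [hu' ->]]].
  exists (fun i => r * g i + g' i), (r * u + u'); split; first exact: imQ.2.
  rewrite -[r *: _]/(r * _) mulrDr addrACA mulr_sumr -big_split; congr (_ + _).
  by apply: eq_bigr => i _; rewrite mulrDl mulrA.
have NS j : N j.+1 = adjoin (N j) (v j).
  apply/seteqP; split=> [_ [g [u [hu ->]]]|z /adjoinP[_ [b [[g [u [hu ->]]] ->]]]].
    apply/adjoinP; exists (u + \sum_(i < j) g i * v i), (g j).
    by split; [exists g, u|rewrite big_ord_recr addrA].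
  exists (fun i => if (i < j)%N then g i else b), u; split=> //.
  rewrite big_ord_recr /= ltnn addrA; congr (_ + _ + _).
  by apply: eq_bigr => i _; rewrite ltn_ord.
have mQN j : mQ `<=` N j.
  by move=> u hu; exists (fun=> 0), u; rewrite big1 ?addr0 // => i _; rewrite mul0r.
have NQ j : (j <= n.+1)%N -> N j `<=` Q.
  move=> hj _ [g [u [hu ->]]]; apply: (idealD iQ); first exact: ideal_mul_subr iQ _ hu.
  elim/big_ind: _ => [|x y|i _]; [exact: ideal0 iQ|exact: (idealD iQ)|].
  by apply: (idealM _ iQ) => //; apply: Qv; have := ltn_ord i; lia.
have cN j : cofinite (N j) by exact: (cofiniteS _ _ (@mQN j) cmQ).
(* Otherwise l(Q/mQ) would be at least n + 1; but it is at most l(Q/aQ) = l(R/aR) = n - 1. *)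
have [j hj Nv] : exists2 j, (j <= n)%N & N j (v j).
  apply: contrapT => hn.
  have count j : (j <= n.+1)%N -> (colen (N j) + j <= colen mQ)%N.
    elim: j => [_|j IH hj]; first by rewrite addn0; exact: colenS.
    have nv : ~ N j (v j) by move=> h; apply: hn; exists j.
    have mv x : m x -> N j (x * v j) by move=> mx; apply: mQN; apply: in_mul => //; exact: Qv.
    by have := IH (ltnW hj); rewrite NS (colen_adjoin noethR localR (iN j) (cN j) nv mv); lia.
  have := count n.+1 (leqnn _); have := colenS (iN n.+1) iQ (NQ _ (leqnn _)) (cN n.+1).
  by move: le_mQ; rewrite eaQ /n; lia.
have [g [u [hu ev]]] := Nv.
(* Put a = lc + b. Modulo b J^(n-1) each v_i becomes l^i c^n, so the relation for v_j says that p(l)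
   c^n lies in mQ + b J^(n-1). *)
pose p : {poly R} := 'X^j - \poly_(i < j) g i.
have mp : p \is monic.
  rewrite monicE lead_coefDl ?lead_coefXn // size_polyN size_polyXn ltnS; exact: size_poly.
have [l hl] := monic_unit_value mp.
pose b := a - l * c.
have Jb : J b by apply: idealB => //; exact: idealM.
have iJ' : ideal (adjoin (scale c setT) b) by apply: ideal_adjoin; exact: ideal_scale.
have J'c : scale c setT `<=` adjoin (scale c setT) b by exact: adjoinl.
have eJ : J = adjoin (scale c setT) b.
  apply/seteqP; split; apply: adjoin_min => //.
  - apply: scaleT_min => //; have -> : a = l * c + 1 * b by rewrite /b; ring.
    by apply/adjoinP; exists (l * c), 1; split=> //; exists l; rewrite // mulrC.
  - by apply: J'c; exact: scaleT.
  - exact: scaleT_min.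
pose P := scale b (ideal_exp J n.-1).
have iP : ideal P by apply/ideal_scale/ideal_ideal_exp.
have key i : (i <= n)%N -> P (v i - l ^+ i * c ^+ n).
  elim: i => [|i IH] hi; first by rewrite /v !expr0 subn0 subrr; exact: ideal0.
  have e : c ^+ (n - i) = c * c ^+ (n - i.+1) by rewrite -exprS; congr (_ ^+ _); lia.
  have -> : v i.+1 - l ^+ i.+1 * c ^+ n
      = b * (a ^+ i * c ^+ (n - i.+1)) + l * (v i - l ^+ i * c ^+ n).
    by rewrite /v /b e !exprS; ring.
  apply: idealD => //; last by apply: idealM => //; apply: IH; exact: ltnW.
  exists (a ^+ i * c ^+ (n - i.+1)) => //.
  have -> : n.-1 = (i + (n - i.+1))%N by lia.
  by rewrite ideal_expD; apply: in_mul; exact: in_exp.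
have iS : ideal (add_ideal mQ P) by exact: ideal_add.
have hc : add_ideal mQ P (c ^+ n).
  apply: (ideal_unit noethR localR iS hl).
  have -> : p.[l] * c ^+ n = u - ((v j - l ^+ j * c ^+ n)
      - \sum_(i < j) g i * (v i - l ^+ i * c ^+ n)).
    rewrite /p hornerD hornerN hornerXn horner_poly.
    have -> : \sum_(i < j) g i * (v i - l ^+ i * c ^+ n) =
        \sum_(i < j) g i * v i - (\sum_(i < j) g i * l ^+ i) * c ^+ n.
      by rewrite mulr_suml -sumrB; apply: eq_bigr => i _; rewrite mulrBr -[in RHS](mulrA (g i) (l ^+ i)).
    rewrite ev.
    by set A := \sum_(_ < _) _; set B := \sum_(_ < _) _; ring.
  exists u; eexists; split; [exact: hu| |reflexivity].
  apply: idealN => //; apply: idealB => //; first exact: key.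
  elim/big_ind: _ => [|x y|i _]; [exact: ideal0|exact: idealD|].
  by apply: idealM => //; apply: key; have := ltn_ord i; lia.
(* As J = (c, b), J^n lies in c^n R + b J^(n-1), hence in mQ + P, and Nakayama's lemma removes
   mQ. *)
have QP : Q = P.
  apply/seteqP; split; last first.
    by move=> _ [y hy <-]; apply: (in_mul Jb hy).
  apply: (nakayama noethR localR) => //; rewrite -/mQ.
  rewrite {1}/Q {1}eJ; apply: subset_trans (@ideal_exp_add _ _ _ (ideal_scale c idealT)) _.
  rewrite -eJ; apply: add_ideal_min => //.
    rewrite ideal_exp_scale; move=> _ [y _ <-]; exact: idealMR iS hc.
  exact: add_idealr.
exists b, n.-1; split=> //.
(* The element [b] divides a^n, which is regular. *)
move=> z bz; apply: (regularX (n := n) ra).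
have : Q (a ^+ n) by exact: in_exp.
by rewrite QP => -[y _ <-]; rewrite mulrAC bz mul0r.
Qed.

(** Induction on generators, starting from a regular element. If I^(n+1) = bI^n and J = I + uR, then
    J^(n+1) = H J^n for H = (b, u); a reduction b' of H with exponent k gives J^(k+n+1) = b'
    J^(k+n). *)
Lemma principal_reduction K : ideal K -> K `<=` m -> cofinite K -> (exists2 a, K a & regular a) ->
  exists x t, [/\ K x, regular x & ideal_exp K t.+1 = scale x (ideal_exp K t)].
Proof.
move=> iK Km cK [a Ka ra]; have ia := ideal_scale a (@idealT R).
have [s] := noethR iK; rewrite /generates generated_lincomb => es.
have sK u : u \in s -> K u by move=> us; rewrite -es; exact: lincomb_mem.
have -> : K = add_ideal (scale a setT) (lincomb setT s).
  apply/seteqP; split; first by rewrite -{1}es; exact: add_idealr.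
  by apply: add_ideal_min => //; [exact: scaleT_min|exact: lincomb_min].
elim: s sK {es} => [|u s IH] sK.
  have -> : add_ideal (scale a setT) (lincomb setT [::]) = scale a setT.
    by apply/seteqP; split=> [_ [z [_ [hz -> ->]]]|z hz]; [rewrite addr0|exists z, 0; rewrite addr0].
  by exists a, 0%N; split=> //; [exact: scaleT|rewrite ideal_exp1].
have [|b [n [hb rb eb]]] := IH; first by move=> v vs; apply: sK; rewrite inE vs orbT.
set I := add_ideal _ _ in hb eb.
have iI : ideal I by apply: ideal_add => //; exact: ideal_lincomb.
have -> : add_ideal (scale a setT) (lincomb setT (u :: s)) = adjoin I u.
  apply/seteqP; split=> [_ [x [_ [hx [r [y [_ hy ->]]] ->]]]|z /adjoinP[_ [r [[x [y [hx hy ->]]] ->]]]].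
    by apply/adjoinP; exists (x + y), r; split; [exists x, y|ring].
  by exists x, (r * u + y); split=> //; [exists r, y|ring].
set J := adjoin I u; have iJ : ideal J by exact: ideal_adjoin.
have JI : I `<=` J by exact: adjoinl.
have Ju : J u by exact: adjoinr.
have IK : I `<=` K.
  apply: add_ideal_min => //; first exact: scaleT_min.
  by apply: lincomb_min => // v vs; apply: sK; rewrite inE vs orbT.
have [|||b' [k [hb' rb' eb']]] := @pair_reduction b u => //.
- exact/Km/IK.
- by apply/Km/sK; exact: mem_head.
set H := adjoin _ _ in hb' eb'.
have iH : ideal H by exact/ideal_adjoin/ideal_scale.
have HJ : H `<=` J by apply: adjoin_min => //; apply: scaleT_min => //; exact: JI.
have eH : ideal_exp J n.+1 = ideal_mul H (ideal_exp J n).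
  apply/seteqP; split; last exact: ideal_mulS.
  apply: subset_trans (@ideal_exp_add _ _ _ iI) _.
  apply: add_ideal_min; first exact: ideal_ideal_mul.
    rewrite eb => _ [y hy <-]; apply: in_mul; first by apply: adjoinl; exact: scaleT.
    exact: (ideal_exp_subS JI) hy.
  by move=> _ [y hy <-]; apply: in_mul => //; exact/adjoinr/ideal_scale.
have eHk i : ideal_exp J (i + n) = ideal_mul (ideal_exp H i) (ideal_exp J n).
  elim: i => [|i IHi]; first by rewrite ideal_mulC ideal_mulT //; exact: ideal_ideal_exp.
  by rewrite addSn -addnS ideal_expD eH ideal_mulA (ideal_mulC _ H) -ideal_mulA -ideal_expD IHi ideal_mulA.
exists b', (k + n)%N; split=> //; first exact: HJ.
by rewrite -addSn !eHk eb' ideal_mul_scale.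
Qed.

End PrincipalReduction.

(** * Hilbert coefficients and minimal multiplicity *)

Section Hilbert.
Local Open Scope classical_set_scope.
Local Open Scope ring_scope.
Variable R : comNzRingType.
Hypothesis creg : forall y : R, regular y -> cofinite (scale y setT).
Implicit Types (I J K : set R) (x y a b : R).

Lemma cofinite_mem I x : ideal I -> I x -> regular x -> cofinite I.
Proof.
move=> iI Ix rx; apply: (cofiniteS _ _ (scaleT_min iI Ix) (creg rx)) => //; exact: ideal_scale.
Qed.

Lemma colen_scaleX x n I : regular x -> ideal I -> cofinite I ->
  colen (scale (x ^+ n) I) = (n * colen (scale x setT) + colen I)%N.
Proof.
move=> rx iI cI; elim: n => [|n IH]; first by rewrite expr0 scale1.
have iE := ideal_scale (x ^+ n) iI.
have [cE _] := colen_scale (regularX (n := n) rx) iI (creg (regularX (n := n) rx)) cI.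
have [_] := colen_scale rx iE (creg rx) cE.
by rewrite scaleA -exprS IH mulSn addnA.
Qed.

Lemma reduction_expD I x t k : ideal_exp I t.+1 = scale x (ideal_exp I t) ->
  ideal_exp I (k + t) = scale (x ^+ k) (ideal_exp I t).
Proof.
move=> e; elim: k => [|k IH]; first by rewrite expr0 scale1.
by rewrite addSn -addnS ideal_expD e ideal_mul_scaler -ideal_expD IH scaleA exprS.
Qed.

Lemma reduction_expS I x t k : ideal_exp I t.+1 = scale x (ideal_exp I t) ->
  ideal_exp I (k + t).+1 = scale x (ideal_exp I (k + t)).
Proof.
by move=> e; rewrite -addSn !(reduction_expD _ e) scaleA -exprS.
Qed.

(** Once I^(t+1) = x I^t, all later powers are I^(k+t) = x^k I^t. Comparing l(R/I^(k+t)) = ke +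
    l(R/I^t) with e(k+t) - e1 gives this value. *)
Definition hilbert_e1 I x t : int := (t * colen (scale x setT))%:Z - (colen (ideal_exp I t))%:Z.

Section Coefficients.
Variables (I : set R) (x : R) (t : nat).
Hypotheses (iI : ideal I) (Ix : I x) (rx : regular x).
Hypothesis red : ideal_exp I t.+1 = scale x (ideal_exp I t).

Lemma cofinite_exp n : cofinite (ideal_exp I n).
Proof.
apply: (@cofinite_mem _ (x ^+ n)); [exact: ideal_ideal_exp|exact: in_exp|exact: regularX].
Qed.

Lemma colength_exp n : (t <= n)%N ->
  (colen (ideal_exp I n))%:Z = (colen (scale x setT))%:Z * n%:Z - hilbert_e1 I x t.
Proof.
move=> /subnK <-; rewrite (reduction_expD _ red) colen_scaleX //; last exact: cofinite_exp.
  by rewrite /hilbert_e1; lia.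
exact: ideal_ideal_exp.
Qed.

Lemma hilbert_reduction : hilbert_coefficients I (colen (scale x setT)) (hilbert_e1 I x t).
Proof.
exists t => n tn; exists (colen (ideal_exp I n.+1)); first exact/colenP/cofinite_exp.
by rewrite colength_exp //; lia.
Qed.

Lemma hilbert_uniq e0 e1 : hilbert_coefficients I e0 e1 ->
  e0 = colen (scale x setT) /\ e1 = hilbert_e1 I x t.
Proof.
move=> [n0 h]; pose n := maxn n0 t.
have [l hl el] := h n (leq_maxl _ _).
have [l' hl' el'] := h n.+1 (leq_trans (leq_maxl _ _) (leqnSn _)).
have tn : (t <= n)%N by exact: leq_maxr.
have := colength_exp (leq_trans tn (leqnSn n)).
have := colength_exp (leq_trans tn (leq_trans (leqnSn n) (leqnSn n.+1))).
rewrite (colen_eq hl) (colen_eq hl') el el'.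
set e := (colen _)%:Z; set f := hilbert_e1 _ _ _.
rewrite -![n.+2%:Z]/(1 + n.+1)%:Z PoszD !mulrDr !mulr1; lia.
Qed.

End Coefficients.

Lemma reduction_scale I K a b x t : regular a -> regular b -> scale a I = scale b K -> K x ->
  ideal_exp K t.+1 = scale x (ideal_exp K t) ->
  exists y, [/\ I y, a * y = b * x & ideal_exp I t.+1 = scale y (ideal_exp I t)].
Proof.
move=> ra rb e Kx red.
have [y Iy ey] : scale a I (b * x) by rewrite e; exists x.
exists y; split=> //; apply: (scaleI (regularX (n := t.+1) ra)).
rewrite -ideal_exp_scale e ideal_exp_scale red scaleA scaleA.
have -> : a ^+ t.+1 * y = b * x * a ^+ t by rewrite -ey exprS; ring.
rewrite -[RHS]scaleA -ideal_exp_scale e ideal_exp_scale scaleA; congr (scale _ _).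
by rewrite exprS; ring.
Qed.

(** Passing to aI adds l(R/aR) to l(R/yR) and t l(R/aR) to l(R/I^t); the difference defining e1 is
    unchanged. *)
Lemma hilbert_e1_scale I K a b x y t : ideal I -> ideal K ->
  regular a -> regular b -> regular x -> regular y -> I y -> K x ->
  scale a I = scale b K -> a * y = b * x -> hilbert_e1 I y t = hilbert_e1 K x t.
Proof.
move=> iI iK ra rb rx ry Iy Kx e exy.
have cI := cofinite_exp Iy ry t; have cK := cofinite_exp Kx rx t.
have e1 : scale (a ^+ t) (ideal_exp I t) = scale (b ^+ t) (ideal_exp K t).
  by rewrite -!ideal_exp_scale e.
have := congr1 (@colen R) e1; rewrite !colen_scaleX //; try exact: ideal_ideal_exp.
have iT := @idealT R.
have [_ h1] := colen_scale ra (ideal_scale y iT) (creg ra) (creg ry).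
have [_ h2] := colen_scale rb (ideal_scale x iT) (creg rb) (creg rx).
have : colen (scale a (scale y setT)) = colen (scale b (scale x setT)) by rewrite !scaleA exy.
rewrite h1 h2 /hilbert_e1; set A := colen (scale a _); set B := colen (scale b _).
set X := colen (scale x _); set Y := colen (scale y _) => h.
have := congr1 (muln t) h; rewrite !mulnDr; lia.
Qed.

End Hilbert.

(** * Minimal multiplicity, almost Gorenstein rings and colength two *)

Section MinimalMultiplicity.
Local Open Scope classical_set_scope.
Local Open Scope ring_scope.
Variables (R : comNzRingType) (m K : set R).
Hypotheses (noethR : noetherian R) (localR : local_ring m) (dimR : krull_dim R 1).
Hypotheses (canK : canonical_ideal m K) (redK : is_reduction K m).
Variables (x : R) (t : nat).
Hypotheses (Kx : K x) (rx : regular x) (red : ideal_exp K t.+1 = scale x (ideal_exp K t)).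

Let im : ideal m. Proof. by case: localR => -[]. Qed.
Let m1 : ~ m 1. Proof. by case: localR => -[]. Qed.
Let creg (y : R) : regular y -> cofinite (scale y setT).
Proof. exact: (cofinite_regular noethR localR dimR). Qed.
Let iK : ideal K. Proof. exact: canonical_ideal_ideal canK. Qed.
Let sK : simple_socle m K. Proof. exact: canonical_simple_socle dimR canK. Qed.
Let Km : K `<=` m. Proof. by case: redK. Qed.
Let mx : m x. Proof. exact: Km. Qed.
Let cK : cofinite K. Proof. exact: (cofinite_mem creg iK Kx rx). Qed.
Let cx : cofinite (scale x setT). Proof. exact: creg. Qed.
Let ix : ideal (scale x setT). Proof. exact: ideal_scale. Qed.
Let ixm : ideal (scale x m). Proof. exact: ideal_scale. Qed.
Let imK : ideal (ideal_mul m K). Proof. exact: ideal_ideal_mul. Qed.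
Let imm : ideal (ideal_mul m m). Proof. exact: ideal_ideal_mul. Qed.
Let e := colen (scale x setT).

Let cofinite_xm : cofinite (scale x m).
Proof. by have [] := colen_scale rx im cx (cofinite_m noethR localR). Qed.

Let colen_xm : colen (scale x m) = e.+1.
Proof.
by have [_ ->] := colen_scale rx im cx (cofinite_m noethR localR); rewrite (colen_m noethR localR) addn1.
Qed.

Lemma reduction_max : exists n, ideal_exp m n.+1 = scale x (ideal_exp m n).
Proof.
have [_ [n en]] := redK.
have h k : ideal_exp m (k + n) = ideal_mul (ideal_exp K k) (ideal_exp m n).
  elim: k => [|k IH]; first by rewrite ideal_mulC ideal_mulT //; exact: ideal_ideal_exp.
  by rewrite addSn -addnS ideal_expD en ideal_mulA (ideal_mulC _ K) -ideal_mulA -ideal_expD IH ideal_mulA.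
by exists (t + n)%N; rewrite -addSn !h red ideal_mul_scale.
Qed.

(** If x were in mJ, then J^(k+1) = x J^k would lie in m J^(k+1) and vanish by Nakayama's lemma,
    although it contains the regular element x^(k+1). *)
Let reduction_not_in_mul (J : set R) k : ideal J -> J x ->
  ideal_exp J k.+1 = scale x (ideal_exp J k) -> ~ ideal_mul m J x.
Proof.
move=> iJ Jx eJ h.
have : ideal_exp J k.+1 `<=` [set 0].
  apply: (nakayama0 noethR localR); [exact: ideal_ideal_exp|exact: (@ideal_lincomb R setT [::] idealT)|].
  rewrite {1}eJ => _ [y hy <-]; rewrite ideal_expS ideal_mulA; exact: in_mul.
move=> /(_ (x ^+ k.+1) (in_exp _ Jx)) e0.
by apply: m1; rewrite (regularX (n := k.+1) rx (y := 1)) ?mulr1 //; exact: ideal0.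
Qed.

(** An element xb of mJ with b a unit would put x in mJ. *)
Let mul_sub_scale (J : set R) : ~ ideal_mul m J x -> J x ->
  ideal_mul m J `<=` scale x setT -> ideal_mul m J = scale x m.
Proof.
move=> nx Jx h; apply/seteqP; split=> z hz.
  have [b _ eb] := h _ hz; exists b => //; apply: contrapT => nb; apply: nx.
  apply: (ideal_unit noethR localR (ideal_ideal_mul _ _) nb).
  by rewrite mulrC eb.
by case: hz => b mb <-; rewrite mulrC; exact: in_mul.
Qed.

Lemma colon_x : colen (colon (scale x setT) m) = (e + colen K - colen (ideal_mul m K))%N.
Proof. by have := colen_type noethR localR iK cK sK mx rx cx; rewrite -/e; lia. Qed.

Lemma socle_of_colon : socle_of m x setT = colon (scale x setT) m.
Proof. by apply/seteqP; split=> [a [_ h] b mb|a h]; [|split=> // b mb]; rewrite mulrC; exact: h. Qed.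

Let cmK : cofinite (ideal_mul m K).
Proof. by apply: (cofinite_mem creg imK (x := x * x)); [exact: in_mul|exact: regularM]. Qed.

Let le_mK : (colen K <= colen (ideal_mul m K))%N.
Proof. by apply: colenS => //; exact: ideal_mul_subr. Qed.

Lemma type_colen r : cm_type_dim1 m r <-> (r + colen K = colen (ideal_mul m K))%N.
Proof.
have iS := ideal_colon m ix.
have xS : scale x setT `<=` colon (scale x setT) m by exact: colon_sub.
have [cS le hl] := cofinite_split ix iS xS cx.
have h := colen_type noethR localR iK cK sK mx rx cx.
have er : (colen (scale x setT) - colen (colon (scale x setT) m) = colen (ideal_mul m K) - colen K)%N.
  lia.
rewrite er -socle_of_colon in hl; split=> [/(cm_type_socle localR mx rx) hr|hr].
  by rewrite (has_length_uniq hr hl); lia.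
apply: (cm_type_exists localR canK mx rx).
by have -> : r = (colen (ideal_mul m K) - colen K)%N by lia.
Qed.

(** Always xm lies in m^2, and l(m/xm) = l(R/xR) = e. Hence mu(m) = l(m/m^2) equals e exactly when
    the two ideals coincide. *)
Lemma minimal_multiplicity_iff : minimal_multiplicity m <-> ideal_mul m m = scale x m.
Proof.
have cmm : cofinite (ideal_mul m m).
  by apply: (cofinite_mem creg imm (x := x * x)); [exact: in_mul|exact: regularM].
have xmm : scale x m `<=` ideal_mul m m by move=> _ [y my <-]; exact: in_mul.
have [n en] := reduction_max.
have ng := min_num_gens_colen noethR localR im cmm.
have cm := colen_m noethR localR.
split=> [[e' [/ng e1 [f /(hilbert_uniq creg mx rx en)[e2 _]]]]|emm].
  symmetry; apply: colen_inj => //.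
  rewrite colen_xm /e; case: e2 => <-; rewrite cm in e1.
  have := colenS imm im (ideal_mul_subr (I := m) im) cmm; rewrite cm; lia.
exists e; split; first by apply/ng; rewrite emm colen_xm cm subn1.
exists (hilbert_e1 m x n); exact: (hilbert_reduction creg mx rx en).
Qed.

Lemma colon_max : ~ m `<=` scale x setT -> ideal_mul m m `<=` scale x setT ->
  colen (colon (scale x setT) m) = 1%N.
Proof.
move=> nm hm; suff -> : colon (scale x setT) m = m by rewrite (colen_m noethR localR).
have iS := ideal_colon m ix.
apply/seteqP; split; last by move=> a ma b mb; apply: hm; exact: in_mul.
apply: (proper_sub_max noethR localR) => // h; apply: nm => a ma.
by have := h a ma; rewrite mul1r.
Qed.

Lemma colen2_minimal_multiplicity : ideal_mul m K `<=` scale x setT -> colen K = 2%N ->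
  ideal_mul m m = scale x m.
Proof.
move=> hmK K2; have nK := reduction_not_in_mul iK Kx red.
have [n en] := reduction_max.
apply: mul_sub_scale => //; first exact: reduction_not_in_mul im mx en.
have emK := mul_sub_scale nK Kx hmK.
have h1 : colen (colon (scale x setT) m) = 1%N.
  by rewrite colon_x emK colen_xm K2; lia.
have iS := ideal_colon m ix.
have cS : cofinite (colon (scale x setT) m).
  by apply: (cofiniteS _ _ _ cx) => //; exact: colon_sub.
have Sm : colon (scale x setT) m `<=` m.
  apply: (proper_sub_max noethR localR) => // /(ideal1 iS) eT.
  by move: h1; rewrite eT colenT.
have eS : colon (scale x setT) m = m.
  by apply: colen_inj => //; rewrite h1 (colen_m noethR localR).
apply: ideal_mul_min => // a b ma mb.
have : colon (scale x setT) m a by rewrite eS.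
exact.
Qed.

Lemma maximal_not_sub : ~ regular_local m -> ~ m `<=` scale x setT.
Proof.
move=> nreg h; apply: nreg; exists 1%N; split=> //.
have em : m = scale x setT by apply/seteqP; split=> //; exact: scaleT_min.
split.
  exists [:: x] => //; rewrite /generates generated_lincomb em.
  apply/seteqP; split=> [_ [a [_ [_ -> ->]]]|_ [a _ <-]].
    by exists a; rewrite // addr0 mulrC.
  by exists a, 0; rewrite addr0 mulrC.
move=> [|//]; rewrite /generates generated_lincomb /= => e0.
have x0 : x = 0 by have : m x by []; rewrite -e0.
by case: m1; rewrite (rx (y := 1)) ?x0 ?mul0r //; exact: ideal0.
Qed.

Lemma minimal_multiplicity_colen : ~ regular_local m -> ideal_mul m m = scale x m ->
  almost_gorenstein m /\ colen K = 2%N.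
Proof.
move=> nreg emm; have nm := maximal_not_sub nreg.
have hm : ideal_mul m m `<=` scale x setT.
  by rewrite emm => _ [b _ <-]; exists b.
have h1 := colon_max nm hm.
have emK : ideal_mul m K = scale x m.
  apply/seteqP; split; first by rewrite -emm; exact: ideal_mulS.
  by move=> _ [b mb <-]; rewrite mulrC; exact: in_mul.
have := colon_x; rewrite h1 emK colen_xm => h2.
have K2 : colen K = 2%N by lia.
split=> //; exists K => //.
have [r hr] : exists r, (r + colen K = colen (ideal_mul m K))%N.
  by exists (colen (ideal_mul m K) - colen K)%N; rewrite subnK.
exists (e : int), (hilbert_e1 K x t), r; split.
- exact: (hilbert_reduction creg Kx rx red).
- exact/type_colen.
rewrite emK colen_xm K2 in hr.
(* For t > 0, K^t lies in m^t = x^(t-1) m, so l(R/K^t) >= (t-1)e + 1 and e1(K) <= e - 1 = r. For t =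
   0 the coefficient is 0. *)
have em k : ideal_exp m k.+1 = scale (x ^+ k) m.
  elim: k => [|k IH]; first by rewrite expr0 scale1 ideal_exp1.
  by rewrite ideal_expS IH ideal_mul_scaler emm scaleA -exprSr.
rewrite /hilbert_e1; case: (t) => [|k]; first by rewrite mul0n colenT; lia.
have := colenS (ideal_ideal_exp K k.+1) (ideal_ideal_exp m k.+1)
  (ideal_exp_subS (n := k.+1) Km) (cofinite_exp creg Kx rx k.+1).
rewrite em colen_scaleX //; last exact: cofinite_m noethR localR.
by rewrite (colen_m noethR localR) -/e; lia.
Qed.

Lemma principal_of_square : ideal_mul K K `<=` scale x K -> K `<=` scale x setT.
Proof.
move=> h a Ka; apply: (canonical_endomorphism noethR localR iK cK sK rx cx) => k Kk.
by apply: h; exact: in_mul.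
Qed.

Lemma almost_gorenstein_sub : almost_gorenstein m -> ideal_mul m K `<=` scale x setT.
Proof.
move=> [I canI [e0 [e1 [r [hI /type_colen hr e1r]]]]].
have iI := canonical_ideal_ideal canI.
have sI := canonical_simple_socle localR dimR canI.
have cI : cofinite I.
  have [n0 h] := hI; have [l hl _] := h n0 (leqnn n0).
  apply: (cofiniteS (I := ideal_exp I n0.+1)) => //; [exact: ideal_ideal_exp|exact: ideal_exp_sub|].
  by exists l.
have [a [b [ra rb eIK]]] := canonical_ideal_uniq noethR localR mx rx creg iI cI sI iK cK sK.
(* Two is added so that a product uv of elements of K fits into K^s beside x^t: from K^s = x^(t+1)
   K, cancelling x^t gives uv in xK, even for t = 0. *)
have red2 := reduction_expS 2 red; set s := (2 + t)%N in red2.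
have [y [Iy exy redI]] := reduction_scale ra rb eIK Kx red2.
have ry : regular y by apply: (@regular_factor _ a); rewrite exy; exact: regularM.
have [_ e1E] := hilbert_uniq creg Iy ry redI hI.
rewrite e1E (hilbert_e1_scale creg s iI iK ra rb rx ry Iy Kx eIK exy) /hilbert_e1 in e1r.
have es : s = (1 + t).+1 by [].
have iP := ideal_scale (x ^+ (1 + t)) iK.
have iE := ideal_ideal_exp K s.
have sub : scale (x ^+ (1 + t)) K `<=` ideal_exp K s.
  by move=> _ [k Kk <-]; rewrite es mulrC; apply: in_mul => //; exact: (in_exp (1 + t) Kx).
have [cP _] := colen_scale (regularX (n := (1 + t)%N) rx) iK (creg (regularX (n := (1 + t)%N) rx)) cK.
have := colen_scaleX creg (1 + t) rx iK cK; rewrite -/e => eP'.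
case: (leqP (colen (scale (x ^+ (1 + t)) K)) (colen (ideal_exp K s))) => le.
  have h := colen_inj iP iE sub cP le.
  apply: subset_trans (ideal_mul_subr (I := m) iK) _; apply: principal_of_square.
  apply: ideal_mul_min => [|u v Ku Kv]; first exact: ideal_scale.
  apply: (@scale_mem _ (x ^+ t)); first exact: regularX.
  rewrite scaleA -exprSr h es ideal_expS mulrCA; apply: in_mul => //.
  by rewrite ideal_expS mulrC; apply: in_mul => //; exact: in_exp.
(* Now e1 >= e - l(R/K) + 1, so l(R/mK) = r + l(R/K) >= e + 1. Adjoining x to mK lowers the colength
   by at most 1, hence not below e = l(R/xR), and mK + xR is xR. *)
have mxK c : m c -> ideal_mul m K (c * x) by move=> mc; exact: in_mul.
have iA := ideal_adjoin x imK.
have leA := colen_adjoin_le noethR localR imK cmK mxK.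
have xA : scale x setT `<=` adjoin (ideal_mul m K) x by apply: scaleT_min => //; exact: adjoinr.
have -> : scale x setT = adjoin (ideal_mul m K) x.
  apply: colen_inj => //; rewrite -/e; move: e1r; rewrite {1}es -/e mulSn.
  move: eP' le leA hr; set A := (_ * e)%N; lia.
exact: adjoinl.
Qed.

Lemma index2_sub : t = 2%N -> ~ K `<=` scale x setT -> colen K = 2%N ->
  ideal_mul m K `<=` scale x setT.
Proof.
move=> t2 nK K2; have := red; rewrite t2 => red2.
pose c := colon (scale x setT) K; have ic : ideal c by exact: ideal_colon.
have c_mul a k : c a -> K k -> exists b, a * k = x * b.
  by move=> ca Kk; have [b _ <-] := ca k Kk; exists b.
(* For k in K, k1 k2 k lies in K^3 = xK^2, and aK^2 lies in xK; so a k1 k2 multiplies K into x^2 K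
   and lies in x^2 R. The case a = x gives K^2 inside xR. *)
have f1 a k1 k2 : c a -> K k1 -> K k2 -> scale (x * x) setT (a * (k1 * k2)).
  move=> ca Kk1 Kk2.
  have rxx := regularM rx rx.
  apply: (canonical_endomorphism noethR localR iK cK sK rxx (creg rxx)) => k Kk.
  have : ideal_exp K 3 (k1 * (k2 * (k * 1))) by do 3!apply: in_mul => //.
  rewrite red2 mulr1 => -[q hq eq].
  have : ideal_mul K K `<=` colon (scale x K) [set a].
    apply: ideal_mul_min => [|u v Ku Kv _ ->]; first exact/ideal_colon/ideal_scale.
    have [b eb] := c_mul a u ca Ku.
    by exists (b * v); [exact: idealM|rewrite mulrA -eb; ring].
  rewrite ideal_expS ideal_exp1 // in hq.
  move=> /(_ q hq a erefl)[j Kj ej].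
  exists j => //; rewrite -mulrA ej.
  have -> : a * (k1 * k2) * k = a * (k1 * (k2 * k)) by ring.
  by rewrite -eq; ring.
have cx' : c x by move=> k _; exists k.
have Kc : K `<=` c.
  move=> k1 Kk1 k2 Kk2; have [b _ eb] := f1 x k1 k2 cx' Kk1 Kk2.
  by exists b => //; apply: (regularI rx); rewrite mulrA.
have cc : cofinite c by exact: (cofiniteS _ _ Kc cK).
have c1 : ~ c 1 by move=> h; apply: nK => k Kk; have := h k Kk; rewrite mul1r.
have cm : c `<=` m by exact: (proper_sub_max noethR localR).
have neK : ~ c `<=` K.
  (* Write ak = xb for a, k in K. Then [f1] and cancellation of x^2 put b k2 in xR for every k2 in
     K, so b lies in [c], hence in K: thus K^2 lies in xK. *)
  move=> cK'; apply: nK; apply: principal_of_square.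
  apply: ideal_mul_min => [|a k Ka Kk]; first exact: ideal_scale.
  have [b eb] := c_mul a k (Kc _ Ka) Kk.
  exists b => //; apply: cK' => k2 Kk2.
  have [d _ ed] := f1 a k k2 (Kc _ Ka) Kk Kk2.
  exists d => //; apply: (regularI rx).
  by rewrite mulrA ed mulrA eb mulrA.
have ecm : c = m.
  apply: colen_inj => //; rewrite (colen_m noethR localR) leqNgt; apply/negP => h.
  by apply: neK; rewrite (colen_inj iK ic Kc cK) // K2.
apply: ideal_mul_min => // a k ma Kk.
by have ca : c a by [rewrite ecm]; exact: ca.
Qed.

(** If m = gR, then g^(n+1) in x m^n gives g = xh, so m lies in xR. *)
Lemma regular_principal : regular_local m -> K `<=` scale x setT.
Proof.
move=> [d [/(krull_dim_uniq dimR) <- [[s gs s1] _]]].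
have [n en] := reduction_max.
move: gs; rewrite /generates generated_lincomb; case: s s1 => [|g [|]] // _ em.
have em' : m = scale g setT.
  rewrite -em; apply/seteqP; split=> [_ [a [_ [_ -> ->]]]|_ [a _ <-]].
    by exists a; rewrite // addr0 mulrC.
  by exists a, 0; rewrite addr0 mulrC.
have rg : regular g.
  by have := mx; rewrite em' => -[h _ eh]; apply: (@regular_factor _ h); rewrite mulrC eh.
have : ideal_exp m n.+1 (g ^+ n.+1) by apply: in_exp; rewrite em'; exact: scaleT.
rewrite en em' ideal_exp_scale => -[_ [h _ <-] eh].
have eg : g = x * h.
  by apply: (regularI (regularX (n := n) rg)); rewrite -exprSr -eh; ring.
move=> k /Km; rewrite em' => -[b _ <-]; exists (h * b) => //; by rewrite eg mulrA.
Qed.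

End MinimalMultiplicity.

(** * Principal reductions of canonical ideals and the canonical index *)

Section CanonicalReductions.
Local Open Scope classical_set_scope.
Local Open Scope ring_scope.
Variables (R : comNzRingType) (m K : set R).
Hypotheses (noethR : noetherian R) (localR : local_ring m) (dimR : krull_dim R 1).
Hypotheses (cmR : cohen_macaulay m) (canK : canonical_reduction m K).

Let creg (y : R) : regular y -> cofinite (scale y setT).
Proof. exact: (cofinite_regular noethR localR dimR). Qed.

Lemma canonical_reduction_regular : exists2 a, K a & regular a.
Proof.
have [z mz rz] := exists_regular dimR cmR.
have [canI [Km [n en]]] := canK; exists (z ^+ n.+1); last exact: regularX.
have iK := canonical_ideal_ideal canI.
by have := in_exp n.+1 mz; rewrite en => /(ideal_mul_subl iK).
Qed.

Lemma canonical_reduction_principal : infinite_residue_field m ->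
  exists x t, [/\ K x, regular x & ideal_exp K t.+1 = scale x (ideal_exp K t)].
Proof.
move=> infk; have [a Ka ra] := canonical_reduction_regular.
have [canI [Km _]] := canK; have iK := canonical_ideal_ideal canI.
apply: (principal_reduction noethR localR infk creg iK Km); last by exists a.
exact: (cofinite_mem creg iK Ka ra).
Qed.

(** If yz = 0, then z kills T^3 = yT^2, and faithfulness of T, used once for each factor, gives z =
    0. *)
Lemma faithful_reduction_regular (T : set R) y : canonical_ideal m T -> T y ->
  ideal_exp T 3 = scale y (ideal_exp T 2) -> regular y.
Proof.
move=> canT Ty e z yz.
have [w mw rw] := exists_regular dimR cmR.
have faithful := canonical_faithful noethR localR dimR canT mw rw.
apply: (faithful) => c1 Tc1; apply: (faithful) => c2 Tc2; apply: (faithful) => c3 Tc3.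
have : ideal_exp T 3 (c1 * (c2 * (c3 * 1))) by do 3!apply: in_mul => //.
rewrite e mulr1 => -[q _ eq].
have -> : z * c1 * c2 * c3 = z * (c1 * (c2 * c3)) by ring.
by rewrite -eq mulrA (mulrC z) yz mul0r.
Qed.

Lemma canonical_index2_reduction : canonical_index m 2 ->
  exists x, [/\ K x, regular x, ideal_exp K 3 = scale x (ideal_exp K 2)
    & ~ K `<=` scale x setT].
Proof.
move=> [T canT [[y Ty ey] min]].
have ry := faithful_reduction_regular canT Ty ey.
have [z mz rz] := exists_regular dimR cmR.
have [canI _] := canK.
have iK := canonical_ideal_ideal canI; have iT := canonical_ideal_ideal canT.
have sK := canonical_simple_socle localR dimR canI.
have sT := canonical_simple_socle localR dimR canT.
have [k Kk rk] := canonical_reduction_regular.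
have cK := cofinite_mem creg iK Kk rk; have cT := cofinite_mem creg iT Ty ry.
have [b [a [rb ra e]]] := canonical_ideal_uniq noethR localR mz rz creg iK cK sK iT cT sT.
have [x [Kx exy ex]] := reduction_scale rb ra e Ty ey.
exists x; split=> //.
  by apply: (@regular_factor _ b); rewrite exy; exact: regularM.
(* If K were xR, then T = yR would have reduction number 0. *)
move=> Kx'; apply: (min 0%N) => //; exists y => //.
rewrite ideal_exp1 //; apply: (scaleI ra); rewrite -e.
have -> : K = scale x setT by apply/seteqP; split=> //; exact: scaleT_min.
by rewrite [RHS]scaleA scaleA exy.
Qed.

End CanonicalReductions.

(* A discrete valuation ring has mu(m) = e = 1 and its only canonical reduction
   is K = m, of colength 1; hence the regular case must be excluded from the
   direct implication of the first equivalence. *)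
Theorem proposition3p8 (R : comNzRingType) (m K : set R)
    (noethR : noetherian R) (localR : local_ring m)
    (dimR : krull_dim R 1) (cmR : cohen_macaulay m)
    (infk : infinite_residue_field m) (canK : canonical_reduction m K) :
  ((~ regular_local m -> minimal_multiplicity m ->
      almost_gorenstein m /\ colength K 2) /\
   (almost_gorenstein m /\ colength K 2 -> minimal_multiplicity m)) /\
  (canonical_index m 2 ->
     (almost_gorenstein m /\ minimal_multiplicity m <-> colength K 2)).
Proof.
have [canI redK] := canK.
have iK := canonical_ideal_ideal canI.
have cK : cofinite K.
  have [a Ka ra] := canonical_reduction_regular dimR cmR canK.
  exact: (cofinite_mem (cofinite_regular noethR localR dimR) iK Ka ra).
have colen2 : colen K = 2%N -> colength K 2 by move=> <-; exact: colenP.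
split; first split.
- have [x [t [Kx rx red]]] := canonical_reduction_principal noethR localR dimR cmR canK infk.
  move=> nreg /(minimal_multiplicity_iff noethR localR dimR canI redK Kx rx red).
  by move=> /(minimal_multiplicity_colen noethR localR dimR canI redK Kx rx red nreg)[? /colen2].
- have [x [t [Kx rx red]]] := canonical_reduction_principal noethR localR dimR cmR canK infk.
  move=> [/(almost_gorenstein_sub noethR localR dimR canI redK Kx rx red) sub /colen_eq K2].
  apply/(minimal_multiplicity_iff noethR localR dimR canI redK Kx rx red).
  exact: (colen2_minimal_multiplicity noethR localR dimR canI redK Kx rx red).
move=> /(canonical_index2_reduction noethR localR dimR cmR canK)[x [Kx rx red nK]].
(* Index 2 excludes regular rings, so (b) needs no exception. *)
have nreg : ~ regular_local m.
  by move=> /(regular_principal dimR redK Kx rx red).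
have mmP := minimal_multiplicity_iff noethR localR dimR canI redK Kx rx red.
have mmK := minimal_multiplicity_colen noethR localR dimR canI redK Kx rx red nreg.
split=> [[_ /mmP/mmK[_ /colen2]//]|/colen_eq K2].
have sub := index2_sub noethR localR dimR canI Kx rx red erefl nK K2.
have emm := colen2_minimal_multiplicity noethR localR dimR canI redK Kx rx red sub K2.
by split; [exact: (mmK emm).1|exact/mmP].
Qed.
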